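(* Let $f$ be a positive integer, $s\in\{0,1,2,\dots,f\}$, and for non-negative integers $n_1,\dots,n_f$ put $N_i:=n_i+n_{i+1}+\dots+n_f$ for $i=1,\dots,f$, with $N_{f+1}:=0$. Then for $|q|<1$, \[ \sum_{m,n,n_1,\dots,n_f\geq 0}\frac{q^{2m^2+6mn+6n^2+N_1^2+\dots+N_f^2+N_{f-s+1}+\dots+N_f}(q;q)_{n_f}}{(q;q)_m(q^3;q^3)_n(q;q)_{n_f-3n-2m}(q;q)_{n_1}\cdots(q;q)_{n_{f-1}}(q;q)_{2n_f}} = \frac{(q^{f+1-s},q^{5f+5+s},q^{6(f+1)};q^{6(f+1)})_\infty(q^{4f+4+2s},q^{8f+8-2s};q^{12(f+1)})_\infty}{(q;q)_\infty}, \] where for $s=0$ the linear term $N_{f-s+1}+\dots+N_f$ in the exponent is the empty sum $0$.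
   Context: For a variable $a$ and a non-negative integer $n$, $(a;q)_n=\prod_{k=0}^{n-1}(1-aq^k)$, $(a_1,\dots,a_k;q)_n=(a_1;q)_n\cdots(a_k;q)_n$, and for $|q|<1$, $(a;q)_\infty=\lim_{n\to\infty}(a;q)_n$ (similarly for several arguments). By convention $1/(q;q)_n=0$ for negative integers $n$, so summands with $n_f-3n-2m<0$ vanish. *)

(* Defs.v *)
From HB Require Import structures.
From mathcomp Require Import all_boot all_order all_algebra finmap complex.
From mathcomp Require Import boolp classical_sets functions reals topology.
From mathcomp Require Import normedtype sequences.
From mathcomp.analysis.showcase Require Import summability.

Set Implicit Arguments.
Unset Strict Implicit.
Unset Printing Implicit Defensive.

Import Order.TTheory GRing.Theory Num.Theory.
Import numFieldNormedType.Exports.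

Local Open Scope classical_set_scope.
Local Open Scope ring_scope.

(* Limits are taken over an abstract numFieldType, which carries the topology
   of its norm; R[i] has no topological structure of its own, but it is a
   numFieldType, so these definitions apply to it. *)

Definition qpoch {K : numFieldType} (a q : K) (n : nat) : K :=
  \prod_(k < n) (1 - a * q ^+ k).

(* (a_1, ..., a_k; q)_n *)
Definition qpochs {K : numFieldType} (s : seq K) (q : K) (n : nat) : K :=
  \prod_(a <- s) qpoch a q n.

(* (a_1, ..., a_k; q)_oo *)
Definition qpochs_inf {K : numFieldType} (s : seq K) (q : K) : K :=
  lim (qpochs s q n @[n --> \oo]).

(* 1 / (q; q)_n for an integer n, equal to 0 when n is negative. *)
Definition inv_qpoch {K : numFieldType} (q : K) (n : int) : K :=
  match n with
  | Posz k => (qpoch q q k)^-1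
  | Negz _ => 0
  end.

(* Unconditional (equivalently, over R or C, absolute) convergence: the limit
   is along the finite subsets of I directed by inclusion. *)
Definition has_sum {K : numFieldType} {I : choiceType} (F : I -> K) (l : K) :=
  partial_sum F @ totally --> l.

(* The index i is 1-based: part ns i is n_i for ns = (n_1, ..., n_f). *)
Definition part {f : nat} (ns : f.-tuple nat) (i : nat) : nat :=
  nth 0%N ns i.-1.

(* N_i = n_i + ... + n_f for 1 <= i <= f + 1. *)
Definition tail_sum {f : nat} (ns : f.-tuple nat) (i : nat) : nat :=
  (\sum_(i <= j < f.+1) part ns j)%N.

(* Main.v *)
(* Write u_n = 1/(q;q)_n and let c_j = 1, 0, -1 for j = 0, 1, 2 mod 3.
   - Both sides of
       (q;q)_L sum_{m,n} q^(2m^2+6mn+6n^2) u_(L-2m-3n) / ((q;q)_m (q^3;q^3)_n)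
         = (q;q)_(2L) sum_j c_j q^(j^2) u_(L-j) u_(L+j)
     satisfy the same second order recurrence in L; on the right the recurrence
     holds termwise in j up to c_(j-1) + c_j + c_(j+1) = 0.  So the inner sum
     over m, n is a Bailey pair.
   - Iterating the Bailey lemma with a = q (s times) and then a = 1 turns the
     truncated multisum into sum_j c_j q^((f+1)j^2+sj) u_(M-j) u_(M+j).  One may
     pass from a = q to a = 1 because c_(-1-j) = -c_j.
   - Letting M go to infinity (Tannery) leaves the theta series
     sum_j c_j q^((f+1)j^2+sj), summed by the quintuple product identity in base
     Q = q^(6(f+1)) at z = -q^(f+1-s).  The latter is the limit of a finite
     identity of Chen, Chu and Gu, proved by a WZ certificate. *)

Require Import Defs.
From mathcomp Require Import all_boot all_order all_algebra finmap complex.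
From mathcomp Require Import boolp classical_sets reals topology normedtype.
From mathcomp Require Import sequences exp.
From mathcomp.analysis.showcase Require Import summability.
From mathcomp Require Import ring lra zify.

Set Implicit Arguments.
Unset Strict Implicit.
Unset Printing Implicit Defensive.

Import Order.TTheory GRing.Theory Num.Theory.
Import numFieldNormedType.Exports.

Local Open Scope classical_set_scope.
Local Open Scope ring_scope.

(** The recurrence of the m,n-sum is obtained by duality. [dsum] pairs the coefficients [dterm] with
    a test function, and each first order relation of [dterm] moves a shift onto it. For functions
    of k = 2m + 3n this gives an operator of order four; on finitely supported functions it factors
    through one of order three, which is low enough for a second order recurrence in L.

    Extending 1/(q;q)_n by 0 keeps u(n-1) = (1 - q^n) u(n) true at every integer, so sums over a
    large enough fixed box have no boundary terms.

    The linear exponent sits on the innermost s sums; hence the a = q steps precede the a = 1 steps.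

    At level M the multisum carries an extra weight u(M - N_1), which tends to a constant
    independent of the summation variables. One estimate comparing weighted and plain sums serves
    both to take the limit of the theta side and to prove that the multisum converges. *)

(* The window -B <= j < B is stable under j -> -1 - j. *)
Definition zsum {K : numFieldType} (B : nat) (f : int -> K) : K :=
  \sum_(i < B) (f (Posz i) + f (Negz i)).

Section ZSum.
Variable K : numFieldType.
Implicit Types (f g : int -> K) (B : nat).

Lemma eq_zsum B f g : (forall j, f j = g j) -> zsum B f = zsum B g.
Proof. by move=> fg; apply: eq_bigr => i _; rewrite !fg. Qed.

Lemma zsumD B f g : zsum B (fun j => f j + g j) = zsum B f + zsum B g.
Proof. by rewrite /zsum -big_split; apply: eq_bigr => i _ /=; rewrite addrACA. Qed.

Lemma zsumZ B a f : zsum B (fun j => a * f j) = a * zsum B f.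
Proof. by rewrite /zsum mulr_sumr; apply: eq_bigr => i _; rewrite mulrDr. Qed.

Lemma zsumS B f : zsum B.+1 f = zsum B f + (f (Posz B) + f (Negz B)).
Proof. by rewrite /zsum big_ord_recr. Qed.

Lemma zsum_exchange B (n : nat) (F : nat -> int -> K) :
  \sum_(r < n) zsum B (F r) = zsum B (fun j => \sum_(r < n) F r j).
Proof. by rewrite exchange_big; apply: eq_bigr => i _; rewrite big_split. Qed.

Lemma zsum_shift B f :
  zsum B (fun j => f (j + 1)) = zsum B f + f B%:Z - f (- B%:Z).
Proof.
elim: B => [|B IH]; first by rewrite /zsum !big_ord0 oppr0 addrK.
rewrite !zsumS IH.
have -> : Posz B + 1 = B.+1%:Z by lia.
have -> : Negz B + 1 = - B%:Z by lia.
have -> : - B.+1%:Z = Negz B by lia.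
ring.
Qed.

Lemma zsum_antisym B f : (forall j, f (- 1 - j) = - f j) -> zsum B f = 0.
Proof.
move=> fN; apply: big1 => i _; have -> : Negz i = -1 - Posz i by lia.
by rewrite fN subrr.
Qed.
End ZSum.

(** * q-Pochhammer symbols and their reciprocals at integer arguments *)

Section QSeries.
Variables (K : numFieldType) (q : K).
Hypotheses (q_neq0 : q != 0) (q_nroot : forall n, q ^+ n.+1 != 1).

Local Notation u := (inv_qpoch q).

Lemma qpochS (a : K) n : qpoch a q n.+1 = qpoch a q n * (1 - a * q ^+ n).
Proof. by rewrite /qpoch big_ord_recr. Qed.

Lemma qpoch0 (a b : K) : qpoch a b 0 = 1.
Proof. by rewrite /qpoch big_ord0. Qed.

Lemma qpochSl (a : K) n : qpoch a q n.+1 = (1 - a) * qpoch (a * q) q n.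
Proof.
rewrite /qpoch big_ord_recl /= expr0 mulr1; congr (_ * _).
by apply: eq_bigr => i _; rewrite /bump /= exprS mulrA.
Qed.

Lemma qpoch_cat (a : K) m n :
  qpoch a q (m + n) = qpoch a q m * qpoch (a * q ^+ m) q n.
Proof.
elim: n => [|n IH]; first by rewrite addn0 qpoch0 mulr1.
by rewrite addnS !qpochS IH -!mulrA exprD.
Qed.

Lemma qfactor_neq0 n : 1 - q * q ^+ n != 0.
Proof. by rewrite subr_eq0 eq_sym -exprS. Qed.

Lemma qpoch_neq0 n : qpoch q q n != 0.
Proof. by rewrite /qpoch; apply/prodf_neq0 => i _; exact: qfactor_neq0. Qed.

Lemma inv_qpoch_neg (n : int) : n < 0 -> u n = 0.
Proof. by case: n. Qed.

(** At n = 0 the zero convention for negative arguments agrees with the factor 1 - q^0, so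
    summations need no case split at the ends of their range. *)
Lemma inv_qpoch_rec (n : int) : u (n - 1) = (1 - q ^ n) * u n.
Proof.
case: n => [[|n]|n].
- by rewrite expr0z subrr mul0r.
- have -> : n.+1%:Z - 1 = n%:Z by rewrite intS addrC addKr.
  rewrite /= qpochS -exprnP exprS invfM mulrCA mulfV ?mulr1 //.
  exact: qfactor_neq0.
- by rewrite /= mulr0.
Qed.

Lemma qzD (m n : int) : q ^ (m + n) = q ^ m * q ^ n.
Proof. exact: expfzDr. Qed.

Lemma qzN (m : int) : q ^ (- m) = (q ^ m)^-1.
Proof. by rewrite -invr_expz. Qed.

Lemma qz_neq0 (m : int) : q ^ m != 0.
Proof. exact: expfz_neq0. Qed.

Lemma qz2 (m : int) : q ^ (2 * m) = q ^ m * q ^ m.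
Proof. by rewrite -qzD; congr (_ ^ _); lia. Qed.

Lemma qz3 (m : int) : q ^ (3 * m) = q ^ m * q ^ m * q ^ m.
Proof. by rewrite -!qzD; congr (_ ^ _); lia. Qed.

(** * The double sum *)

Definition dterm m n : K :=
  q ^+ (2 * m ^ 2 + 6 * m * n + 6 * n ^ 2)
    / (qpoch q q m * qpoch (q ^+ 3) (q ^+ 3) n).

Lemma q3poch_neq0 n : qpoch (q ^+ 3) (q ^+ 3) n != 0.
Proof.
rewrite /qpoch; apply/prodf_neq0 => i _.
by rewrite subr_eq0 eq_sym -exprS -exprM mulnS addSn.
Qed.

Lemma dterm_recm m n :
  (1 - q ^+ m.+1) * dterm m.+1 n = q ^+ (4 * m + 6 * n + 2) * dterm m n.
Proof.
rewrite /dterm qpochS -exprS.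
have -> : (2 * m.+1 ^ 2 + 6 * m.+1 * n + 6 * n ^ 2 =
  (4 * m + 6 * n + 2) + (2 * m ^ 2 + 6 * m * n + 6 * n ^ 2))%N by lia.
rewrite [q ^+ (4 * m + _ + 2 + _)]exprD; field.
by rewrite qpoch_neq0 q3poch_neq0 exprS qfactor_neq0.
Qed.

Lemma dterm_recn m n :
  (1 - q ^+ (3 * n.+1)) * dterm m n.+1 = q ^+ (6 * m + 12 * n + 6) * dterm m n.
Proof.
have h : 1 - q ^+ (3 * n.+1) != 0.
  by rewrite subr_eq0 eq_sym mulnS addSn; exact: q_nroot.
rewrite /dterm /qpoch [\prod_(k < n.+1) _]big_ord_recr -!/(qpoch _ _ _) /=.
rewrite -exprS -exprM.
have -> : (2 * m ^ 2 + 6 * m * n.+1 + 6 * n.+1 ^ 2 =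
  (6 * m + 12 * n + 6) + (2 * m ^ 2 + 6 * m * n + 6 * n ^ 2))%N by lia.
rewrite [q ^+ (6 * m + _ + 6 + _)]exprD; field.
by rewrite qpoch_neq0 q3poch_neq0 h.
Qed.

Definition dsum B (phi : nat -> nat -> K) : K :=
  \sum_(m < B) \sum_(n < B) dterm m n * phi m n.

Lemma eq_dsum B f g : (forall m n, f m n = g m n) -> dsum B f = dsum B g.
Proof. by move=> fg; do 2![apply: eq_bigr => ? _]; rewrite fg. Qed.

Lemma dsumD B f g : dsum B (fun m n => f m n + g m n) = dsum B f + dsum B g.
Proof.
rewrite /dsum -big_split; apply: eq_bigr => m _; rewrite -big_split /=.
by apply: eq_bigr => n _; rewrite mulrDr.
Qed.

Lemma dsumZ B a f : dsum B (fun m n => a * f m n) = a * dsum B f.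
Proof.
rewrite /dsum mulr_sumr; apply: eq_bigr => m _; rewrite mulr_sumr.
by apply: eq_bigr => n _; rewrite mulrCA.
Qed.

Lemma dsum0 B f : (forall m n, f m n = 0) -> dsum B f = 0.
Proof. by move=> f0; do 2![apply: big1 => ? _]; rewrite f0 mulr0. Qed.

(** Summation by parts: [dterm_recm] trades the factor 1 - q^m for a shift of m in the test
    function. The m = 0 term dies by 1 - q^0, the top one by the hypothesis. *)
Lemma dsum_shiftm B (f : nat -> nat -> K) : (forall n, f B n = 0) ->
  dsum B (fun m n => (1 - q ^+ m) * f m n) =
  dsum B (fun m n => q ^+ (4 * m + 6 * n + 2) * f m.+1 n).
Proof.
move=> f0.
have h m n : dterm m.+1 n * ((1 - q ^+ m.+1) * f m.+1 n) =
    dterm m n * (q ^+ (4 * m + 6 * n + 2) * f m.+1 n).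
  by rewrite mulrCA mulrA dterm_recm; ring.
case: B f0 => [|B] f0; first by rewrite /dsum !big_ord0.
rewrite /dsum big_ord_recl big1 ?add0r; last first.
  by move=> n _; rewrite expr0 subrr mul0r mulr0.
rewrite [RHS]big_ord_recr /= [X in _ = _ + X]big1 ?addr0; last first.
  by move=> n _; rewrite f0 !mulr0.
by do 2![apply: eq_bigr => ? _]; rewrite h.
Qed.

Lemma dsum_shiftn B (f : nat -> nat -> K) : (forall m, f m B = 0) ->
  dsum B (fun m n => (1 - q ^+ (3 * n)) * f m n) =
  dsum B (fun m n => q ^+ (6 * m + 12 * n + 6) * f m n.+1).
Proof.
move=> f0.
have h m n : dterm m n.+1 * ((1 - q ^+ (3 * n.+1)) * f m n.+1) =
    dterm m n * (q ^+ (6 * m + 12 * n + 6) * f m n.+1).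
  by rewrite mulrCA mulrA dterm_recn; ring.
apply: eq_bigr => m _.
case: B f0 m => [|B] f0 m; first by rewrite !big_ord0.
rewrite big_ord_recl expr0 subrr mul0r mulr0 add0r.
rewrite [RHS]big_ord_recr /= f0 !mulr0 addr0.
by apply: eq_bigr => ? _; rewrite h.
Qed.

(* Dual form of the recurrence
   (1 - q^K) d_K = (1+q) q^(2K-2) d_(K-2) + q^(4K-6) d_(K-3) - q^(4K-7) d_(K-4)
   for d_K = sum of dterm m n over 2m + 3n = K. *)
Lemma dsum_rec4 B (phi : nat -> K) : (forall k, (2 * B <= k)%N -> phi k = 0) ->
  dsum B (fun m n => let k := (2 * m + 3 * n)%N in
    (1 - q ^+ k) * phi k - (1 + q) * q ^+ (2 * k + 2) * phi k.+2
    - q ^+ (4 * k + 6) * phi k.+3 + q ^+ (4 * k + 9) * phi k.+4) = 0.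
Proof.
move=> phi0.
(* The left sides of [E1] and [E2] add up to (1 - q^(2m)) phi + q^(2m) (1 - q^(3n)) phi = (1 - q^k)
   phi. [E3] trades the q^(m+1) left on the right of [E1] for a q and a term in phi(k+4). *)
have E1 := @dsum_shiftm B
  (fun m n => (1 + q ^+ m) * phi (2 * m + 3 * n)%N) _.
have E2 := @dsum_shiftn B
  (fun m n => q ^+ (2 * m) * phi (2 * m + 3 * n)%N) _.
have E3 := @dsum_shiftm B
  (fun m n => q ^+ (2 * (2 * m + 3 * n) + 3) * phi (2 * m + 3 * n).+2%N) _.
have {}E1 := E1 (fun n => ltac:(rewrite phi0 ?mulr0 //; lia)).
have {}E2 := E2 (fun n => ltac:(rewrite phi0 ?mulr0 //; lia)).
have {}E3 := E3 (fun n => ltac:(rewrite phi0 ?mulr0 //; lia)).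
set Y1 := dsum _ _ in E1; set X1 := dsum _ _ in E1.
set Y2 := dsum _ _ in E2; set X2 := dsum _ _ in E2.
set Y3 := dsum _ _ in E3; set X3 := dsum _ _ in E3.
transitivity (Y1 + Y2 + (-1) * Y3 + (-1) * X1 + (-1) * X2 + X3); last first.
  by rewrite E1 E2 E3; ring.
rewrite /X1 /X2 /X3 /Y1 /Y2 /Y3 -!dsumZ -!dsumD; apply: eq_dsum => m n /=.
have -> : (2 * m.+1 + 3 * n = (2 * m + 3 * n).+2)%N by lia.
have -> : (2 * m + 3 * n.+1 = (2 * m + 3 * n).+3)%N by lia.
rewrite !(exprS, exprD, mulnDr, mulnS, mulnA, muln1).
by ring.
Qed.

(* The fourth order operator applied to psi is the third order one applied to
   psi(k) + q^(k+1) psi(k+1), whose second summand has smaller support. *)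
Lemma dsum_rec3 B (psi : nat -> K) : (forall k, (2 * B <= k)%N -> psi k = 0) ->
  dsum B (fun m n => let k := (2 * m + 3 * n)%N in
    (1 - q ^+ k) * psi k - q ^+ k.+1 * (1 - q ^+ k) * psi k.+1
    - q ^+ (2 * k + 2) * (1 + q ^+ k.+1) * psi k.+2
    + q ^+ (3 * k + 5) * psi k.+3) = 0.
Proof.
(* The support bound [N] is separated from [B]: it decreases in the induction while the box stays
   fixed. *)
have [N leN] : exists2 N, (N <= 2 * B)%N & N = (2 * B)%N by exists (2 * B)%N.
move=> <-; elim: N leN psi => [|N IH] leN psi psi0.
  by apply: dsum0 => m n /=; rewrite !psi0 //; ring.
have E4 := @dsum_rec4 B psi (fun k hk => psi0 k (leq_trans leN hk)).
have := IH (ltnW leN) (fun k => q ^+ k.+1 * psi k.+1)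
  (fun k hk => ltac:(rewrite /= psi0 ?mulr0 //)).
move=> E3; rewrite -[RHS]subr0 -{1}E4 -[in RHS]E3 -mulN1r -dsumZ -dsumD.
apply: eq_dsum => m n /=; set k := (2 * m + 3 * n)%N.
rewrite !exprS !exprD; ring.
Qed.

(** For L < 2B the box contains every nonzero term, so this is the full inner sum at n_f = L. *)
Definition dconv B (L : int) : K :=
  dsum B (fun m n => u (L - (2 * m + 3 * n)%:Z)).

Lemma dconv_rec B (L : int) : L < (2 * B)%:Z ->
  (1 - q ^ L) * dconv B L =
  (1 + q - q ^ (2 * L - 1)) * dconv B (L - 1)
  - (q + q ^ L - q ^ (2 * L - 2) - q ^ (3 * L - 3)) * dconv B (L - 2).
Proof.
move=> ltLB.
(* With this weight, once every u(L-k-i) is reduced to u(L-k), the summand of [dsum_rec3] is the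
   difference of the two sides, term by term in m and n. *)
have := @dsum_rec3 B (fun k => q ^ (2 * (L - k%:Z)) * u (L - k%:Z)).
move=> /(_ (fun k hk => ltac:(rewrite /= inv_qpoch_neg ?mulr0 //; lia))) E.
apply/eqP; rewrite -subr_eq0 -[X in _ == X]E opprB -[_ - _ * dconv _ (L - 1)]addrC.
rewrite addrA -mulNr -!dsumZ -!dsumD; apply/eqP/eq_dsum => m n /=.
set k := (2 * m + 3 * n)%N; set U := u (L - k%:Z).
have -> : L - k.+1%:Z = L - k%:Z - 1 by lia.
have -> : L - k.+2%:Z = L - k%:Z - 1 - 1 by lia.
have -> : L - k.+3%:Z = L - k%:Z - 1 - 1 - 1 by lia.
have -> : L - 1 - k%:Z = L - k%:Z - 1 by lia.
have -> : L - 2 - k%:Z = L - k%:Z - 1 - 1 by lia.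
rewrite !inv_qpoch_rec -/U.
rewrite !(qz2, qz3, qzD, qzN, expr1z) -!exprnP !exprS !exprD.
by field; rewrite !expf_neq0.
Qed.
End QSeries.

(** * The coefficients of period three *)

Definition coef3 {K : numFieldType} (j : int) : K :=
  if (3 %| j)%Z then 1 else if (3 %| j + 1)%Z then -1 else 0.

Lemma int_mod3 (j : int) :
  exists k : int, [\/ j = 3 * k, j = 3 * k + 1 | j = 3 * k + 2].
Proof.
have := divz_eq j 3; have := @ltz_pmod j 3 isT; have := @modz_ge0 j 3 isT.
move: (j %/ 3)%Z (j %% 3)%Z => k -[[|[|[|//]]]|//] _ _ ->; exists k.
- by constructor 1; ring.
- by constructor 2; ring.
- by constructor 3; ring.
Qed.

Section Coef3.
Variable K : numFieldType.

Lemma coef3_0 (k : int) : coef3 (3 * k) = 1 :> K.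
Proof. by rewrite /coef3 dvdz_mulr. Qed.

Lemma coef3_1 (k : int) : coef3 (3 * k + 1) = 0 :> K.
Proof.
have h (i : int) : (3 %| 3 * k + i)%Z = (3 %| i)%Z by rewrite rpredDl ?dvdz_mulr.
by rewrite /coef3 -addrA !h.
Qed.

Lemma coef3_2 (k : int) : coef3 (3 * k + 2) = -1 :> K.
Proof.
have h (i : int) : (3 %| 3 * k + i)%Z = (3 %| i)%Z by rewrite rpredDl ?dvdz_mulr.
by rewrite /coef3 -addrA !h.
Qed.

Lemma coef3_antisym (j : int) : coef3 (- 1 - j) = - coef3 j :> K.
Proof.
have [k [->|->|->]] := int_mod3 j.
- have -> : -1 - 3 * k = 3 * (- k - 1) + 2 by ring.
  by rewrite coef3_0 coef3_2.
- have -> : -1 - (3 * k + 1) = 3 * (- k - 1) + 1 by ring.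
  by rewrite !coef3_1 oppr0.
- have -> : -1 - (3 * k + 2) = 3 * (- k - 1) by ring.
  by rewrite coef3_0 coef3_2 opprK.
Qed.

Lemma coef3_sum (j : int) : coef3 (j + 1) + coef3 (j - 1) = - coef3 j :> K.
Proof.
have [k [->|->|->]] := int_mod3 j.
- have -> : 3 * k - 1 = 3 * (k - 1) + 2 by ring.
  by rewrite coef3_0 coef3_1 coef3_2 add0r.
- have -> : 3 * k + 1 + 1 = 3 * k + 2 by ring.
  by rewrite addrK coef3_0 coef3_1 coef3_2 oppr0 addNr.
- have -> : 3 * k + 2 + 1 = 3 * (k + 1) by ring.
  have -> : 3 * k + 2 - 1 = 3 * k + 1 by ring.
  by rewrite coef3_0 coef3_1 coef3_2 opprK addr0.
Qed.
End Coef3.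

(** * The Bailey pair: the inner double sum as a signed sum over j *)

Section KeyIdentity.
Variables (K : numFieldType) (q : K).
Hypotheses (q_neq0 : q != 0) (q_nroot : forall n, q ^+ n.+1 != 1).

Local Notation u := (inv_qpoch q).
Let qzD := qzD q_neq0.
Let qzN := qzN q.
Let qz2 := qz2 q_neq0.
Let qz3 := qz3 q_neq0.
Let inv_qpoch_rec := inv_qpoch_rec q_nroot.

Definition gterm (L j : int) : K := q ^ (j * j) * u (L - j) * u (L + j).

Lemma gterm_eq0 (L j : int) : (L < j) || (L < - j) -> gterm L j = 0.
Proof.
rewrite /gterm; case/orP => h.
  by rewrite (@inv_qpoch_neg _ q (L - j)) ?mulr0 ?mul0r//; lia.
by rewrite (@inv_qpoch_neg _ q (L + j)) ?mulr0//; lia.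
Qed.

(** This is [dconv_rec] transported by dconv = (q;q)_(2L) / (q;q)_L gsum: the new factors are
    quotients of this prefactor at L, L-1 and L-2. The two neighbours j-1 and j+1 stand where -1
    appears in [dconv_rec], since their sum acts as -1 against [coef3]. *)
Lemma gterm_rec (L j : int) :
  (1 + q ^ (L - 1)) * (1 - q ^ (2 * L - 3)) * (1 - q ^ (2 * L - 1))
    * (1 - q ^ (2 * L)) * gterm L j =
  (1 + q ^ (L - 1)) * (1 - q ^ (2 * L - 3)) *
    ((1 + q) * gterm (L - 1) j
     + q ^ (2 * L - 1) * (gterm (L - 1) (j - 1) + gterm (L - 1) (j + 1)))
  - (q + q ^ L - q ^ (2 * L - 2) - q ^ (3 * L - 3)) * gterm (L - 2) j.
Proof.
rewrite /gterm.
have -> : L - 1 - j = L - j - 1 by lia.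
have -> : L - 1 + j = L + j - 1 by lia.
have -> : L - 2 - j = L - j - 1 - 1 by lia.
have -> : L - 2 + j = L + j - 1 - 1 by lia.
have -> : L - 1 - (j - 1) = L - j by lia.
have -> : L - 1 + (j - 1) = L + j - 1 - 1 by lia.
have -> : L - 1 - (j + 1) = L - j - 1 - 1 by lia.
have -> : L - 1 + (j + 1) = L + j by lia.
have -> : (j - 1) * (j - 1) = j * j - 2 * j + 1 by ring.
have -> : (j + 1) * (j + 1) = j * j + 2 * j + 1 by ring.
have -> : 2 * L - 3 = 2 * L - 1 - 1 - 1 by lia.
have -> : 2 * L - 2 = 2 * L - 1 - 1 by lia.
have -> : 3 * L - 3 = 3 * L - 1 - 1 - 1 by lia.
rewrite !inv_qpoch_rec.
have := qz_neq0 q_neq0 j; have := qz_neq0 q_neq0 L.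
move: (u (L - j)) (u (L + j)) => U V.
rewrite !(qz2, qz3, qzD, qzN, expr1z).
move: (q ^ L) (q ^ j) (q ^ (j * j)) => X Y J X0 Y0.
by field; rewrite q_neq0 Y0.
Qed.

Definition gsum B (L : int) : K := zsum B (fun j => coef3 j * gterm L j).

(** The bound keeps the support of [gterm] away from the ends of the window, so shifting j costs
    nothing. *)
Lemma gsum_shift B (L : int) : L + 1 < B%:Z ->
  zsum B (fun j => coef3 j * (gterm L (j - 1) + gterm L (j + 1))) = - gsum B L.
Proof.
move=> ltLB.
have E1 := zsum_shift B (fun j => coef3 j * gterm L (j - 1)).
have E2 := zsum_shift B (fun j => coef3 (j - 1) * gterm L j).
rewrite !gterm_eq0 ?mulr0 ?subr0 ?addr0 in E1 E2; try lia.
under eq_zsum => j do rewrite mulrDr.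
rewrite zsumD -E1.
under [X in _ + X]eq_zsum => j do rewrite -{1}[j](addrK 1).
rewrite E2 -zsumD /gsum -[RHS]mulN1r -zsumZ; apply: eq_zsum => j.
by rewrite addrK -mulrDl coef3_sum; ring.
Qed.

Lemma gsum_rec B (L : int) : L < B%:Z ->
  (1 + q ^ (L - 1)) * (1 - q ^ (2 * L - 3)) * (1 - q ^ (2 * L - 1))
    * (1 - q ^ (2 * L)) * gsum B L =
  (1 + q ^ (L - 1)) * (1 - q ^ (2 * L - 3)) *
    (1 + q - q ^ (2 * L - 1)) * gsum B (L - 1)
  - (q + q ^ L - q ^ (2 * L - 2) - q ^ (3 * L - 3)) * gsum B (L - 2).
Proof.
move=> ltLB.
have E := @gsum_shift B (L - 1); rewrite subrK in E; have {}E := E ltLB.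
set D := (1 + _) * (1 - q ^ (2 * L - 3)).
set P := q ^ (2 * L - 1); set Q := (_ - q ^ (3 * L - 3)).
transitivity (D * (1 + q) * gsum B (L - 1)
    + D * P * (- gsum B (L - 1)) + (- Q) * gsum B (L - 2)); last by ring.
rewrite -E /gsum -!zsumZ -!zsumD; apply: eq_zsum => j.
have := gterm_rec L j; rewrite -/D -/P -/Q => H.
by rewrite mulrCA H; ring.
Qed.

Lemma gsum0 B : (0 < B)%N -> gsum B 0 = 1.
Proof.
case: B => // B _; rewrite /gsum /zsum big_ord_recl big1 => [|i _].
  rewrite /gterm /coef3 /= /gterm /= !qpoch0 !invr1 -[_ * Posz 0]/(0 : int).
  by rewrite expr0z; ring.
by rewrite !gterm_eq0 ?mulr0 ?addr0 //; lia.
Qed.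

Lemma dconv0 B : (0 < B)%N -> dconv q B 0 = 1.
Proof.
case: B => // B _; rewrite /dconv /dsum !big_ord_recl.
rewrite !big1 ?addr0.
- by rewrite /dterm /= !qpoch0 -[(_ + _)%N]/0%N expr0; field.
- move=> i _; apply: big1 => j _.
  by rewrite inv_qpoch_neg ?mulr0 //= /bump; lia.
- by move=> i _; rewrite inv_qpoch_neg ?mulr0 //= /bump; lia.
Qed.

Lemma dconv_neg B (L : int) : L < 0 -> dconv q B L = 0.
Proof. by move=> L0; apply: dsum0 => m n; rewrite inv_qpoch_neg //; lia. Qed.

Lemma gsum_neg B (L : int) : L < 0 -> gsum B L = 0.
Proof.
move=> L0; apply: big1 => i _; rewrite !gterm_eq0 ?mulr0 ?addr0 //; lia.
Qed.

Lemma onep_neq0 n : 1 + q ^+ n.+1 != 0.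
Proof.
apply/eqP => h; have /eqP[] := q_nroot (n.+1 + n).
rewrite -addnS exprD -[q ^+ n.+1](addKr 1) h; ring.
Qed.

Lemma dconv_gsum_step B L : (L.+2 < B)%N ->
  qpoch q q L * dconv q B L = qpoch q q (2 * L) * gsum B L ->
  qpoch q q L.+1 * dconv q B L.+1 = qpoch q q (2 * L.+1) * gsum B L.+1 ->
  qpoch q q L.+2 * dconv q B L.+2 = qpoch q q (2 * L.+2) * gsum B L.+2.
Proof.
move=> ltLB H0 H1.
have E1 := @dconv_rec _ _ q_neq0 q_nroot B L.+2%:Z (ltac:(lia)).
have E2 := @gsum_rec B L.+2%:Z (ltac:(lia)).
have e1 : L.+2%:Z - 1 = L.+1 by lia.
have e2 : L.+2%:Z - 2 = L by lia.
have e3 : 2 * L.+2%:Z - 1 = (2 * L).+3 by lia.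
have e4 : 2 * L.+2%:Z - 2 = (2 * L).+2 by lia.
have e5 : 2 * L.+2%:Z - 3 = (2 * L).+1 by lia.
have e6 : 3 * L.+2%:Z - 3 = (3 * L).+3 by lia.
have e7 : 2 * L.+2%:Z = (2 * L).+4 by lia.
rewrite e3 e4 ?e5 e6 e1 e2 ?e7 -!exprnP in E1 E2.
(* The factor shared by the two leading coefficients of [gsum_rec], to be cancelled at the end. *)
have D0 : (1 + q ^+ L.+1) * (1 - q ^+ (2 * L).+1) != 0.
  by rewrite mulf_neq0 ?onep_neq0 // subr_eq0 eq_sym.
have n2 : (2 * L.+1 = (2 * L).+2)%N by lia.
have n4 : (2 * L.+2 = (2 * L).+4)%N by lia.
rewrite n2 n4 !qpochS in H1 *; apply: (mulfI D0).
move: E1 E2 H0 H1; rewrite !exprS [(2 * L)%N]mulnC [(3 * L)%N]mulnC !exprM.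
move: (dconv q B L.+2) (dconv q B L.+1) (dconv q B L) => g2 g1 g0.
move: (gsum B L.+2) (gsum B L.+1) (gsum B L) => b2 b1 b0.
move: (qpoch q q L) (qpoch q q (L * 2)) (q ^+ L) => P Q X E1 E2 H0 H1.
set D := (X in X * _ = _).
transitivity (D * (P * (1 - q * X)) * ((1 - q * (q * X)) * g2)).
  by rewrite /D; ring.
rewrite E1.
set a := (1 + q - _); set e := (_ - q * (q * (q * X ^+ 3))).
transitivity (D * a * (P * (1 - q * X) * g1) - D * e * (1 - q * X) * (P * g0)).
  by ring.
rewrite H0 H1.
transitivity (Q * (1 - q * X) * (1 + q * X) * (1 - q * X ^+ 2) *
  (D * a * b1 - e * b0)); first by rewrite /D; ring.
rewrite -E2 /D; ring.
Qed.

(** The second order recurrence needs two initial values; the one at L = 1 comes from the recurrence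
    itself, because both sums vanish at L = -1. *)
Lemma dconv_gsum B L : (L < B)%N ->
  qpoch q q L * dconv q B L = qpoch q q (2 * L) * gsum B L.
Proof.
move=> ltLB.
have H0 : qpoch q q 0 * dconv q B 0%N = qpoch q q (2 * 0) * gsum B 0%N.
  by rewrite dconv0 ?gsum0 //; lia.
have H1 : (1 < B)%N ->
    qpoch q q 1 * dconv q B 1%N = qpoch q q (2 * 1) * gsum B 1%N.
  move=> lt1B.
  have := @dconv_rec _ _ q_neq0 q_nroot B 1 (ltac:(lia)).
  have := @gsum_rec B 1 (ltac:(lia)).
  rewrite !subrr (@gsum_neg B (1 - 2)) // (@dconv_neg B (1 - 2)) //.
  rewrite !mulr0 !subr0 gsum0 ?dconv0; try lia.
  have -> : 2 * 1 - 3 = -1 :> int by [].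
  have -> : 2 * 1 - 1 = 1 :> int by [].
  rewrite expr1z expr0z !mulr1 exprN1 => E1 E2.
  rewrite !qpochS !qpoch0 expr0 expr1 mul1r mulr1 E2.
  (* At L = 1 the recurrence carries the factors 1 + q^0 = 2 and 1 - q^(-1); both must be
     cancelled. *)
  have Q0 : 1 - q^-1 != 0.
    apply/eqP => h; have /eqP[] := q_nroot 0; rewrite expr1.
    by apply: (can_inj (@invrK _)); rewrite invr1; apply/esym/subr0_eq.
  apply: (mulfI Q0); apply: (@mulfI _ 2); first by rewrite pnatr_eq0.
  transitivity ((1 + 1) * (1 - q^-1) * (1 + q - q)); first by ring.
  by rewrite -E1 -exprnP; ring.
case: L ltLB => // L ltLB.
have {}ltLB : (L < L.+1 < B)%N by rewrite ltnSn.
pose P k := qpoch q q k * dconv q B k = qpoch q q (2 * k) * gsum B k.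
suff : (L < B)%N -> P L /\ ((L.+1 < B)%N -> P L.+1).
  by case; [lia | move=> _; apply; lia].
elim: L {ltLB} => [|L IH] ltLB; first by split.
have [|h1 h2] := IH; first lia.
split; [exact: h2 | move=> ?; apply: dconv_gsum_step => //; exact: h2].
Qed.
End KeyIdentity.

(** * The Bailey chain *)

Lemma sum_ord_shift (V : zmodType) B j (f : nat -> V) :
  (forall r, (r < j)%N -> f r = 0) -> (forall r, (B <= r)%N -> f r = 0) ->
  \sum_(r < B) f r = \sum_(k < B) f (k + j)%N.
Proof.
elim: j f => [|j IH] f f0 fB; first by under [RHS]eq_bigr do rewrite addn0.
rewrite (_ : \sum_(r < B) f r = \sum_(r < B) f r.+1); last first.
  case: B fB {IH} => [|B] fB; first by rewrite !big_ord0.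
  by rewrite big_ord_recl [RHS]big_ord_recr /= f0 // fB // add0r addr0.
rewrite (IH (fun r => f r.+1)) => [|r|r]; last 2 first.
- by move=> ?; rewrite f0.
- by move=> ?; rewrite fB // ltnW.
by apply: eq_bigr => k _; rewrite addnS.
Qed.

Fixpoint tbox (B f : nat) : seq (f.-tuple nat) :=
  if f is f'.+1 then
    [seq cons_tuple n t | n <- index_iota 0 B, t <- tbox B f']
  else [:: [tuple]].

Lemma big_tboxS (V : zmodType) B f (F : f.+1.-tuple nat -> V) :
  \sum_(t <- tbox B f.+1) F t =
  \sum_(n < B) \sum_(t <- tbox B f) F (cons_tuple (n : nat) t).
Proof. by rewrite /= big_allpairs_dep big_mkord. Qed.

#[local] Arguments inv_qpoch : simpl never.

Section Bailey.
Variables (K : numFieldType) (q : K).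
Hypotheses (q_neq0 : q != 0) (q_nroot : forall n, q ^+ n.+1 != 1).

Local Notation u := (inv_qpoch q).
Let qzD := qzD q_neq0.
Let inv_qpoch_rec := inv_qpoch_rec q_nroot.

Lemma inv_qpoch0 : u 0 = 1.
Proof. by rewrite -[LHS]/((qpoch q q 0)^-1) qpoch0 invr1. Qed.

(** Induction on M for all a at once. Splitting 1 - q^(M+1) = (1 - q^(M+1-k)) + q^(M+1-k) (1 - q^k),
    the first part gives the sum for (M, a), and the second, after shifting k, q^(a+M+1) times the
    sum for (M, a+1). *)
Lemma qchu_vandermonde B M a : (M < B)%N ->
  \sum_(k < B) q ^+ (k * (k + a)) * u (M%:Z - k%:Z) * u k * u (k + a)%N =
  u M * u (M + a)%N.
Proof.
elim: M a => [|M IH] a ltMB.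
  case: B ltMB => // B _; rewrite big_ord_recl big1 => [|i _].
    by rewrite /= subr0 mul0n expr0 addr0 !inv_qpoch0 !mul1r.
  by rewrite inv_qpoch_neg ?mulr0 ?mul0r // /bump /=; lia.
have D0 : 1 - q ^ M.+1 != 0 by rewrite -exprnP exprS qfactor_neq0.
apply: (mulfI D0).
have e : u M = (1 - q ^ M.+1) * u M.+1.
  by rewrite -inv_qpoch_rec; congr u; lia.
have e' : u (M + a)%N = (1 - q ^ (M + a).+1) * u (M + a).+1.
  by rewrite -inv_qpoch_rec; congr u; lia.
rewrite mulrA -e addSn.
transitivity (u M * u (M + a)%N + q ^+ (a + M.+1) * (u M * u (M + a.+1)%N));
    last first.
  rewrite [(M + a.+1)%N]addnS e' -exprnP (_ : (a + M.+1 = (M + a).+1)%N).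
    by ring.
  by lia.
rewrite -(IH a (ltnW ltMB)) -(IH a.+1 (ltnW ltMB)) !mulr_sumr.
pose f (k : nat) : K :=
  q ^+ (k * (k + a)) * q ^ (M.+1%:Z - k%:Z) * u (M.+1%:Z - k%:Z)
    * u (k%:Z - 1) * u (k + a)%N.
have fE : \sum_(k < B) q ^+ (a + M.+1) * (q ^+ (k * (k + a.+1)) *
    u (M%:Z - k%:Z) * u k * u (k + a.+1)%N) = \sum_(k < B) f k.
  rewrite (@sum_ord_shift _ _ 1 f) => [|[]//|r leBr]; last 2 first.
  - by move=> _; rewrite /f (@inv_qpoch_neg _ q (_ - 1)) // mulr0 mul0r.
  - by rewrite /f (@inv_qpoch_neg _ q (M.+1%:Z - _)) ?mulr0 ?mul0r //; lia.
  apply: eq_bigr => k _; rewrite /f addn1.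
  have -> : M.+1%:Z - k.+1%:Z = M%:Z - k%:Z by lia.
  have -> : k.+1%:Z - 1 = k by lia.
  rewrite addSn -addnS !exprnP !mulrA -!qzD.
  by do 3![congr (_ * _)]; congr (_ ^ _); lia.
rewrite fE -big_split; apply: eq_bigr => k _ /=; rewrite /f.
have -> : M%:Z - k%:Z = M.+1%:Z - k%:Z - 1 by lia.
rewrite !inv_qpoch_rec.
have -> : q ^ M.+1 = q ^ (M.+1%:Z - k%:Z) * q ^ k by rewrite -qzD subrK.
ring.
Qed.

(** The kernel of the Bailey lemma with its two free parameters sent to infinity: e = 0 is a = 1, e
    = 1 is a = q. For r = j + k the exponent is j^2 + ej + k(k + 2j + e), which leaves
    [qchu_vandermonde] at M = L - j with shift 2j + e. *)
Lemma bailey_term B L (e j : nat) : (L < B)%N ->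
  \sum_(r < B) q ^+ (r ^ 2 + e * r) * u (L%:Z - r%:Z) * u (r%:Z - j%:Z)
    * u (r%:Z + j%:Z + e%:Z) =
  q ^+ (j ^ 2 + e * j) * u (L%:Z - j%:Z) * u (L%:Z + j%:Z + e%:Z).
Proof.
move=> ltLB; have [lejL|ltLj] := leqP j L; last first.
  rewrite (@inv_qpoch_neg _ q (L%:Z - _)) ?mulr0 ?mul0r; last lia.
  apply: big1 => r _; have [lerL|ltLr] := leqP r L.
    by rewrite (@inv_qpoch_neg _ q (r%:Z - _)) ?mulr0 ?mul0r //; lia.
  by rewrite (@inv_qpoch_neg _ q (L%:Z - _)) ?mulr0 ?mul0r //; lia.
rewrite (@sum_ord_shift _ _ j (fun r => q ^+ (r ^ 2 + e * r) *
  u (L%:Z - r%:Z) * u (r%:Z - j%:Z) * u (r%:Z + j%:Z + e%:Z))); last 2 first.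
- by move=> r ?; rewrite (@inv_qpoch_neg _ q (r%:Z - _)) ?mulr0 ?mul0r //; lia.
- by move=> r ?; rewrite (@inv_qpoch_neg _ q (L%:Z - _)) ?mulr0 ?mul0r //; lia.
have := @qchu_vandermonde B (L - j) (2 * j + e) (leq_ltn_trans (leq_subr _ _) ltLB).
have -> : L%:Z - j%:Z = (L - j)%N by lia.
have -> : L%:Z + j%:Z + e%:Z = (L - j + (2 * j + e))%N by lia.
move=> E; rewrite -[RHS]mulrA -E mulr_sumr; apply: eq_bigr => k _.
have -> : (k + j)%:Z - j%:Z = k by lia.
have -> : L%:Z - (k + j)%:Z = (L - j)%N%:Z - k%:Z by lia.
have -> : (k + j)%:Z + j%:Z + e%:Z = (k + (2 * j + e))%N by lia.
rewrite !mulrA -exprD; do 3![congr (_ * _)]; congr (_ ^+ _); lia.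
Qed.

Lemma bailey_step1 B L (a : int -> K) : (L < B)%N ->
  \sum_(r < B) q ^+ (r ^ 2) * u (L%:Z - r%:Z) *
    zsum B (fun j => a j * u (r%:Z - j) * u (r%:Z + j)) =
  zsum B (fun j => a j * q ^ (j * j) * u (L%:Z - j) * u (L%:Z + j)).
Proof.
move=> ltLB; under eq_bigr => r _ do rewrite -zsumZ.
rewrite (zsum_exchange B B (fun r j => q ^+ (r ^ 2) * u (L%:Z - r%:Z) *
  (a j * u (r%:Z - j) * u (r%:Z + j)))); apply: eq_zsum => j.
(* The kernel is even in j, so [bailey_term] at a natural number covers both signs. *)
have [k [->|->]] : exists k : nat, j = k%:Z \/ j = - k%:Z.
  by case: j => n; [exists n; left | exists n.+1; right; lia].
- have := @bailey_term B L 0 k ltLB; rewrite addr0 mul0n addn0.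
  move=> E.
  transitivity (a k * (q ^+ (k ^ 2) * u (L%:Z - k%:Z) * u (L%:Z + k%:Z))); last first.
    rewrite exprnP (_ : k%:Z * k%:Z = (k ^ 2)%N); [ring | lia].
  rewrite -E mulr_sumr; apply: eq_bigr => r _.
  by rewrite mul0n addn0 addr0; ring.
- have := @bailey_term B L 0 k ltLB; rewrite addr0 mul0n addn0 opprK.
  move=> E.
  transitivity (a (- k%:Z) * (q ^+ (k ^ 2) * u (L%:Z - k%:Z)
    * u (L%:Z + k%:Z))); last first.
    rewrite exprnP (_ : - k%:Z * - k%:Z = (k ^ 2)%N); [ring | lia].
  rewrite -E mulr_sumr; apply: eq_bigr => r _.
  by rewrite mul0n addn0 addr0 ?opprK; ring.
Qed.

Lemma bailey_stepq B L (a : int -> K) : (L < B)%N ->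
  \sum_(r < B) q ^+ (r ^ 2 + r) * u (L%:Z - r%:Z) *
    zsum B (fun j => a j * u (r%:Z - j) * u (r%:Z + j + 1)) =
  zsum B (fun j => a j * q ^ (j * j + j) * u (L%:Z - j) * u (L%:Z + j + 1)).
Proof.
move=> ltLB; under eq_bigr => r _ do rewrite -zsumZ.
rewrite (zsum_exchange B B (fun r j => q ^+ (r ^ 2 + r) * u (L%:Z - r%:Z) *
  (a j * u (r%:Z - j) * u (r%:Z + j + 1)))); apply: eq_zsum => j.
(* For a = q the symmetry of the kernel is j -> -1 - j, which exchanges the two reciprocals. *)
have [k jk] : exists k : nat, j = k%:Z \/ j = - 1 - k%:Z.
  by case: j => n; exists n; [left | right; lia].
have E := @bailey_term B L 1 k ltLB.
transitivity (a j * (q ^+ (k ^ 2 + 1 * k) * u (L%:Z - k%:Z)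
  * u (L%:Z + k%:Z + 1%:Z))); last first.
  rewrite exprnP (_ : j * j + j = (k ^ 2 + 1 * k)%N); last by case: jk => ->; lia.
  case: jk => ->; first by ring.
  have -> : L%:Z - (-1 - k%:Z) = L%:Z + k%:Z + 1 by lia.
  have -> : L%:Z + (-1 - k%:Z) + 1 = L%:Z - k%:Z by lia.
  ring.
rewrite -E mulr_sumr; apply: eq_bigr => r _; rewrite mul1n.
case: jk => ->; first by ring.
have -> : r%:Z - (-1 - k%:Z) = r%:Z + k%:Z + 1 by lia.
have -> : r%:Z + (-1 - k%:Z) + 1 = r%:Z - k%:Z by lia.
ring.
Qed.

Definition cexp (f s : nat) (j : int) : int := f.+1%:Z * (j * j) + s%:Z * j.

(* The difference of the two sides is a sum antisymmetric under j -> -1 - j. *)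
Lemma bailey_switch B s (L : int) :
  zsum B (fun j => coef3 j * q ^ cexp s s j * u (L - j) * u (L + j + 1)) =
  zsum B (fun j => coef3 j * q ^ cexp s s j * u (L - j) * u (L + j)).
Proof.
apply/eqP; rewrite -subr_eq0 -mulN1r -zsumZ -zsumD; apply/eqP.
under eq_zsum => j.
  rewrite (_ : L + j = L + j + 1 - 1) ?inv_qpoch_rec; last by rewrite addrK.
  rewrite subrK.
  over.
apply: etrans (_ : q ^ (L + 1) * zsum B (fun j => coef3 j *
  q ^ (s.+1%:Z * (j * (j + 1))) * u (L - j) * u (L + j + 1)) = 0).
  rewrite -zsumZ; apply: eq_zsum => j.
  have -> : s.+1%:Z * (j * (j + 1)) = cexp s s j + j by rewrite /cexp; lia.
  by rewrite !qzD; ring.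
rewrite zsum_antisym ?mulr0 // => j; rewrite coef3_antisym.
have -> : L - (-1 - j) = L + j + 1 by lia.
have -> : L + (-1 - j) + 1 = L - j by lia.
have -> : (-1 - j) * (-1 - j + 1) = j * (j + 1) by ring.
ring.
Qed.

Definition tsum B f s (L : int) : K :=
  zsum B (fun j => coef3 j * q ^ cexp f s j * u (L - j) * u (L + j)).

(** The outermost variable carries the linear exponent only if s = f + 1. In that case an a = q step
    is made between two uses of [bailey_switch]; otherwise an a = 1 step suffices. *)
Lemma tsum_step B f s L : (L < B)%N -> (s <= f.+1)%N ->
  \sum_(r < B) q ^+ (r ^ 2 + (f < s)%N * r) * u (L%:Z - r%:Z) *
    tsum B f (minn s f) r = tsum B f.+1 s L.
Proof.
move=> ltLB; rewrite leq_eqVlt => /orP[/eqP ->|lesf].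
  rewrite (minn_idPr _) // ltnSn /tsum.
  under eq_bigr => r _ do rewrite -bailey_switch mul1n.
  rewrite bailey_stepq // -bailey_switch; apply: eq_zsum => j.
  rewrite (_ : cexp f.+1 f.+1 j = cexp f f j + (j * j + j)).
    by rewrite qzD; ring.
  by rewrite /cexp; lia.
rewrite (minn_idPl _) // ltnNge -ltnS lesf /= /tsum.
under eq_bigr => r _ do rewrite mul0n addn0.
rewrite bailey_step1 //; apply: eq_zsum => j.
rewrite (_ : cexp f.+1 s j = cexp f s j + j * j).
  by rewrite qzD; ring.
by rewrite /cexp; lia.
Qed.

(** The multisum term with its m,n-sum already replaced by [gsum]. When the head is n_i, [sumn l] is
    N_i and [size l'] is f - i, so [size l' < s] says that N_i is one of the last s sums. *)
Fixpoint cterm B (s : nat) (l : seq nat) : K :=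
  if l is n :: l' then
    q ^+ (sumn l ^ 2 + (size l' < s)%N * sumn l) *
    (if l' is [::] then gsum q B n else u n * cterm B s l')
  else 0.

Lemma cterm_minn B s k l :
  (size l <= k)%N -> cterm B s l = cterm B (minn s k) l.
Proof.
elim: l => //= n l IH lek; rewrite leq_min lek andbT.
by case: l IH lek => // m l IH lek; rewrite IH // ltnW.
Qed.

Lemma cterm_sum B f s M : (M < B)%N -> (s <= f.+1)%N ->
  \sum_(t <- tbox B f.+1) u (M%:Z - (sumn t)%:Z) * cterm B s t =
  tsum B f.+1 s M.
Proof.
elim: f s M => [|f IH] s M ltMB les; rewrite -tsum_step // big_tboxS.
  apply: eq_bigr => n _; rewrite big_seq1 /= addn0.
  rewrite minn0 mulrA [q ^+ _ * _]mulrC; congr (_ * _).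
  apply: eq_zsum => j; rewrite /gterm /cexp.
  have -> : 1%:Z * (j * j) + 0%:Z * j = j * j by lia.
  by ring.
rewrite exchange_big /=.
transitivity (\sum_(t <- tbox B f.+1) cterm B s t *
   \sum_(r < B) u (M%:Z - r%:Z) * q ^+ (r ^ 2 + (f.+1 < s)%N * r)
     * u (r%:Z - (sumn t)%:Z)).
  apply: eq_bigr => t _; rewrite mulr_sumr.
  (* Here r = n_1 + N_2 is N_1, so the Bailey factor u(r - N_2) becomes 1/(q;q)_(n_1). *)
  rewrite (@sum_ord_shift _ _ (sumn t) (fun r => cterm B s t *
    (u (M%:Z - r%:Z) * q ^+ (r ^ 2 + (f.+1 < s)%N * r)
     * u (r%:Z - (sumn t)%:Z)))).
  - apply: eq_bigr => n _; rewrite size_tuple.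
    have -> : (n + sumn t)%:Z - (sumn t)%:Z = n by lia.
    by case: t => -[|m l] //= _; ring.
  - by move=> r ?; rewrite (@inv_qpoch_neg _ q (r%:Z - _)) ?mulr0 ?mul0r //; lia.
  - move=> r ?; rewrite (@inv_qpoch_neg _ q (M%:Z - _)) ?(mulr0, mul0r) //; lia.
under [LHS]eq_bigr => t _ do rewrite mulr_sumr.
rewrite [LHS]exchange_big; apply: eq_bigr => r _.
have E : forall t : f.+1.-tuple nat, cterm B s t = cterm B (minn s f.+1) t.
  by move=> t; apply: cterm_minn; rewrite size_tuple.
rewrite -IH ?geq_minr // mulr_sumr; apply: eq_bigr => t _.
by rewrite -E; ring.
Qed.
End Bailey.

(** * A finite form of the quintuple product identity *)

Definition tri (k : int) : int := ((k * (k - 1)) %/ 2)%Z.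

Lemma tri2 (k : int) : 2 * tri k = k * (k - 1).
Proof.
have /divzK : (2 %| k * (k - 1))%Z.
  have [h|h] : (2 %| k)%Z \/ (2 %| k - 1)%Z by lia.
  - exact: dvdz_mulr.
  - exact: dvdz_mull.
by rewrite mulrC.
Qed.

Section Quintuple.
Variables (K : numFieldType) (q : K).
Hypotheses (q_neq0 : q != 0) (q_nroot : forall n, q ^+ n.+1 != 1).

Local Notation u := (inv_qpoch q).
Let qzD := qzD q_neq0.
Let qzN := qzN q.
Let inv_qpoch_rec := inv_qpoch_rec q_nroot.

Definition quint_term (z : K) (n k : nat) : K :=
  (1 + z * q ^+ k) * qpoch q q n * u k * u (n%:Z - k%:Z) * qpoch z q n.+1
    / qpoch (q ^+ k * z ^+ 2) q n.+1 * z ^+ k * q ^+ (k ^ 2).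

(** The factors [u (k%:Z - 1)] and [u (n.+1%:Z - k%:Z)] make the certificate vanish at k = 0 and k =
    n + 2, so the telescoped sum has no boundary contribution. *)
Definition quint_cert (z : K) (n k : nat) : K :=
  - (q ^ (n.+1%:Z - k%:Z + (k ^ 2)%:Z) * z ^+ k * qpoch q q n * u (k%:Z - 1)
     * u (n.+1%:Z - k%:Z) * qpoch z q n.+1 / qpoch (q ^+ k * z ^+ 2) q n.+1).

Lemma quint_wz (z : K) (n k : nat) :
  (forall i, 1 - q ^+ i * z ^+ 2 != 0) ->
  quint_term z n.+1 k - quint_term z n k =
  quint_cert z n k.+1 - quint_cert z n k.
Proof.
move=> nz; rewrite /quint_term /quint_cert.
have nzW i m : qpoch (q ^+ i * z ^+ 2) q m != 0.
  by apply/prodf_neq0 => j _; rewrite mulrAC -exprD.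
have eW : qpoch (q ^+ k.+1 * z ^+ 2) q n.+1 =
    qpoch (q ^+ k * z ^+ 2) q n.+2 / (1 - q ^+ k * z ^+ 2).
  by rewrite [in RHS]qpochSl mulrAC mulfV ?nz // mul1r exprS; congr qpoch; ring.
rewrite eW.
have -> : n%:Z - k%:Z = n.+1%:Z - k%:Z - 1 by lia.
have -> : n.+1%:Z - k.+1%:Z = n.+1%:Z - k%:Z - 1 by lia.
have -> : k.+1%:Z - 1 = k by lia.
have -> : (k.+1 ^ 2)%N = (k ^ 2)%:Z + k%:Z + k%:Z + 1 :> int by lia.
rewrite !inv_qpoch_rec [qpoch z q n.+2]qpochS [qpoch q q n.+1]qpochS.
rewrite [qpoch (q ^+ k * z ^+ 2) q n.+2]qpochS.
have := nzW k n.+1; have := nz k; have := nz (k + n.+1)%N.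
have := qz_neq0 q_neq0 k.
have -> : n.+1%:Z = n%:Z + 1 by lia.
rewrite exprD !(qzD, qzN) expr1z -!exprnP ![q ^+ n.+1]exprS ![z ^+ k.+1]exprS.
move: (qpoch z q n.+1) (qpoch (q ^+ k * z ^+ 2) q n.+1) (q ^+ (k ^ 2)).
move: (u k) (u _) (q ^+ k) (q ^+ n) (z ^+ k) (qpoch q q n).
move=> U V X N Zk P Z W J X0 n1 n2 W0.
by field; rewrite X0 W0 n2 q_neq0 andbT /= mulrAC.
Qed.

Lemma quint_sum (z : K) n : (forall i, 1 - q ^+ i * z ^+ 2 != 0) ->
  \sum_(k < n.+1) quint_term z n k = 1.
Proof.
move=> nz; elim: n => [|n IH].
  have := nz 0; rewrite mul1r => nz0.
  rewrite big_ord1 /quint_term !qpochS !qpoch0 subrr inv_qpoch0 /= expr0.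
  by field; rewrite -[X in X != 0](_ : 1 - z ^+ 2 = _) // expr2.
have E : \sum_(k < n.+2) quint_term z n k = 1.
  rewrite big_ord_recr /= IH /quint_term (@inv_qpoch_neg _ q (n%:Z - _)); last lia.
  by rewrite !(mulr0, mul0r) addr0.
apply/eqP; rewrite -subr_eq0 -[X in _ - X]E -sumrB.
under eq_bigr do rewrite quint_wz //.
rewrite -(big_mkord predT (fun k => quint_cert z n k.+1 - quint_cert z n k)).
rewrite telescope_sumr // /quint_cert (@inv_qpoch_neg _ q (0%:Z - 1)) //.
rewrite (@inv_qpoch_neg _ q (n.+1%:Z - n.+2%:Z)); last lia.
by rewrite !(mulr0, mul0r) subrr.
Qed.

Lemma qpoch_rev (x : K) m : x != 0 ->
  qpoch (x * q ^ (- m%:Z)) q m =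
  (- x) ^+ m * q ^ (- tri m.+1) * qpoch (q / x) q m.
Proof.
move=> x0; elim: m => [|m IH]; first by rewrite !qpoch0 /tri /= expr0z; ring.
rewrite qpochSl qpochS.
have -> : x * q ^ (- m.+1%:Z) * q = x * q ^ (- m%:Z).
  have -> : - m%:Z = - m.+1%:Z + 1 by lia.
  by rewrite qzD expr1z mulrA.
rewrite IH.
have -> : - tri m.+2 = - tri m.+1 - m.+1%:Z.
  by have := tri2 m.+2; have := tri2 m.+1; lia.
rewrite qzD exprS !qzN -[q ^ m.+1%:Z]exprnP [q ^+ m.+1]exprS.
have := qz_neq0 q_neq0 (tri m.+1).
move: (q ^ tri _) (qpoch _ _ _) (expf_neq0 m q_neq0) => T P X0 T0.
by field; rewrite X0 T0 x0 q_neq0.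
Qed.

Definition quint_coef (z : K) (k : int) : K :=
  (-1) ^ k * z ^ (3 * k) * q ^ (k * k + tri k) * (1 + z * q ^ k).

Lemma qpoch_sqr_neq0 (z : K) m :
  (forall e : int, 1 - q ^ e * z ^+ 2 != 0) -> qpoch (z ^+ 2) q m != 0.
Proof.
by move=> nz; apply/prodf_neq0 => i _; rewrite mulrC exprnP.
Qed.

Lemma qpoch_sqrV_neq0 (z : K) m : z != 0 ->
  (forall e : int, 1 - q ^ e * z ^+ 2 != 0) -> qpoch (q / z ^+ 2) q m != 0.
Proof.
move=> z0 nz; apply/prodf_neq0 => i _.
apply: contraNneq (nz (- i.+1%:Z)) => h; apply/eqP.
transitivity (- q ^ (- i.+1%:Z) * z ^+ 2 * (1 - q / z ^+ 2 * q ^+ i)).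
  rewrite qzN -exprnP [q ^+ i.+1]exprS; field.
  by rewrite z0 q_neq0 expf_neq0.
by rewrite h mulr0.
Qed.

(** This is [quint_sum] for n = 2M at z q^(-M). The shift centres the index at k = i - M, and
    [qpoch_rev] turns the factors with negative powers of q into products based at q/z and q/z^2,
    which converge as M grows. *)
Lemma quint_finite (z : K) M : z != 0 ->
  (forall e : int, 1 - q ^ e * z ^+ 2 != 0) ->
  \sum_(i < (2 * M).+1) quint_coef z (i%:Z - M%:Z)
    * (u i * u ((2 * M)%:Z - i%:Z)
       / (qpoch (z ^+ 2) q i.+1 * qpoch (q / z ^+ 2) q (2 * M - i))) =
  u (2 * M)%N / (qpoch z q M.+1 * qpoch (q / z) q M).
Proof.
move=> z0 nz.
have nzP : qpoch z q M.+1 * qpoch (q / z) q M != 0.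
  (* A vanishing factor of (z;q) or (q/z;q) would, after squaring, give some q^e z^2 = 1, against
     [nz]. *)
  have sq0 (x : K) (e : int) : (x = 1 -> q ^ e * z ^+ 2 = 1) -> 1 - x != 0.
    move=> xE; apply/eqP => /subr0_eq/esym/xE x1.
    by have := nz e; rewrite x1 subrr eqxx.
  rewrite mulf_neq0 //; apply/prodf_neq0 => i _.
    apply: (sq0 _ (i%:Z + i%:Z)) => zq.
    transitivity ((z * q ^+ i) ^+ 2); last by rewrite zq expr1n.
    by rewrite qzD -exprnP; ring.
  apply: (sq0 _ (- i.+1%:Z - i.+1%:Z)) => zq.
  transitivity ((q / z * q ^+ i) ^- 2); last by rewrite zq expr1n invr1.
  by rewrite qzD !qzN -exprnP exprS; field; rewrite z0 q_neq0 expf_neq0.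
pose z' := z * q ^ (- M%:Z).
have nz' i : 1 - q ^+ i * z' ^+ 2 != 0.
  have := nz (i%:Z - M%:Z - M%:Z); apply: contraNneq => <-.
  by rewrite /z' !qzD !qzN -exprnP; apply/eqP; field; rewrite qz_neq0.
have := quint_sum (2 * M) nz'.
set D := qpoch z q _ * _ in nzP *.
move=> E; have -> : u (2 * M)%N / D = u (2 * M)%N / D * 1 by rewrite mulr1.
rewrite -E mulr_sumr; apply: eq_bigr => -[i lei] _ /=.
pose m := (2 * M - i)%N.
have im : (i + m = 2 * M)%N by rewrite subnKC // -ltnS.
clear lei.
have -> : (2 * M)%:Z - i%:Z = m by lia.
rewrite -/m /quint_term.
have -> : (2 * M)%:Z - i%:Z = m by lia.
have -> : qpoch z' q (2 * M).+1 = (- z) ^+ M * q ^ (- tri M.+1) * D.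
  rewrite (_ : (2 * M).+1 = M + M.+1)%N; last lia.
  have z'M : z' * q ^+ M = z.
    by rewrite /z' -mulrA exprnP -qzD addNr expr0z mulr1.
  by rewrite qpoch_cat z'M qpoch_rev // /D; ring.
have -> : qpoch (q ^+ i * z' ^+ 2) q (2 * M).+1 =
    (- z ^+ 2) ^+ m * q ^ (- tri m.+1) * qpoch (q / z ^+ 2) q m
    * qpoch (z ^+ 2) q i.+1.
  have -> : q ^+ i * z' ^+ 2 = z ^+ 2 * q ^ (- m%:Z).
    have -> : - m%:Z = i%:Z - M%:Z - M%:Z by lia.
    by rewrite /z' !qzD -exprnP; ring.
  rewrite (_ : (2 * M).+1 = m + i.+1)%N; last lia.
  rewrite qpoch_cat qpoch_rev ?expf_neq0 //.
  by rewrite -[_ * q ^ _ * q ^+ m]mulrA [q ^+ m]exprnP -qzD addNr expr0z mulr1.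
have pow : (-1) ^ (i%:Z - M%:Z) * z ^ (3 * (i%:Z - M%:Z))
      * q ^ ((i%:Z - M%:Z) * (i%:Z - M%:Z) + tri (i%:Z - M%:Z)) =
    (- z) ^+ M * q ^ (- tri M.+1) * z' ^+ i * q ^+ (i ^ 2)
      / ((- z ^+ 2) ^+ m * q ^ (- tri m.+1)).
  have n10 : -1 != 0 :> K by rewrite oppr_eq0 oner_eq0.
  have mE : m%:Z = M%:Z + M%:Z - i%:Z by lia.
  rewrite -[- z]mulN1r -[- z ^+ 2]mulN1r !exprnP expfzMl [_ ^ m]expfzMl.
  rewrite [z' ^ i]expfzMl !exprz_exp !invfM !invr_expz.
  transitivity ((-1) ^ (M%:Z - m%:Z) * z ^ (M%:Z + i%:Z - 2 * m%:Z)
    * q ^ (- tri M.+1 - M%:Z * i%:Z + (i ^ 2)%:Z + tri m.+1)); last first.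
    rewrite !(expfzDr _ _ n10) !(expfzDr _ _ z0) !qzD !opprK !mulNr.
    ring.
  congr ((-1) ^ _ * z ^ _ * q ^ _); [lia | lia |].
  have := tri2 (i%:Z - M%:Z); have := tri2 M.+1; have := tri2 m.+1.
  have -> : m.+1%:Z = m%:Z + 1 by lia.
  rewrite mE; lia.
have e1 : z' * q ^+ i = z * q ^ (i%:Z - M%:Z) by rewrite /z' qzD -exprnP; ring.
rewrite /quint_coef pow e1 /inv_qpoch.
field; rewrite !qpoch_neq0 // qz_neq0 // nzP !expf_neq0 ?oppr_eq0 ?expf_neq0 //.
by rewrite qpoch_sqr_neq0 // qpoch_sqrV_neq0.
Qed.
End Quintuple.

(** * Limits and unconditional sums in a numeric field *)

Variant seq_lim {K : numFieldType} (u : nat -> K) (l : K) : Prop :=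
  SeqLim of u n @[n --> \oo] --> l.

Section SeqLim.
Variable K : numFieldType.
Implicit Types (u v : nat -> K) (l : K).

Lemma seq_limP u l : seq_lim u l <->
  forall e, 0 < e -> exists N, forall n, (N <= n)%N -> `|u n - l| < e.
Proof.
split=> [[/cvgrPdist_lt ul] e e0|H].
  have [N _ HN] := ul e e0; exists N => n leNn.
  by rewrite distrC; exact: HN.
split; apply/cvgrPdist_lt => e e0; have [N HN] := H e e0.
by exists N => // n /= leNn; rewrite distrC; exact: HN.
Qed.

Lemma seq_limE u l : seq_lim u l -> lim (u n @[n --> \oo]) = l.
Proof. by move=> [ul]; apply: cvg_lim => //; exact: norm_hausdorff. Qed.

Lemma seq_lim_unique u l l' : seq_lim u l -> seq_lim u l' -> l = l'.
Proof. by move=> /seq_limE <- /seq_limE <-. Qed.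

Lemma eq_seq_lim u v l : (forall n, u n = v n) -> seq_lim u l -> seq_lim v l.
Proof. by move=> uv; rewrite (_ : u = v) //; apply/funext. Qed.

Lemma seq_lim_cst l : seq_lim (fun=> l) l.
Proof. by split; exact: cvg_cst. Qed.

Lemma seq_limD u v l l' :
  seq_lim u l -> seq_lim v l' -> seq_lim (fun n => u n + v n) (l + l').
Proof. by move=> [ul] [vl]; split; exact: cvgD. Qed.

Lemma seq_limM u v l l' :
  seq_lim u l -> seq_lim v l' -> seq_lim (fun n => u n * v n) (l * l').
Proof. by move=> [ul] [vl]; split; exact: cvgM. Qed.

Lemma seq_limV u l : l != 0 -> seq_lim u l -> seq_lim (fun n => (u n)^-1) l^-1.
Proof. by move=> l0 [ul]; split; exact: cvgV. Qed.

Lemma seq_lim_sum (I : Type) (s : seq I) (u : I -> nat -> K) (l : I -> K) :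
  (forall i, seq_lim (u i) (l i)) ->
  seq_lim (fun n => \sum_(i <- s) u i n) (\sum_(i <- s) l i).
Proof.
move=> ul; elim: s => [|i s IH].
  by rewrite big_nil; apply: eq_seq_lim _ (seq_lim_cst 0) => n; rewrite big_nil.
rewrite big_cons; apply: eq_seq_lim _ (seq_limD (ul i) IH) => n.
by rewrite big_cons.
Qed.

Lemma seq_lim_sub u l (f : nat -> nat) :
  (forall N, exists M, forall n, (M <= n)%N -> (N <= f n)%N) ->
  seq_lim u l -> seq_lim (fun n => u (f n)) l.
Proof.
move=> finf /seq_limP ul; apply/seq_limP => e /ul[N HN].
by have [M HM] := finf N; exists M => n /HM/HN.
Qed.

Lemma seq_lim_near u v l N :
  (forall n, (N <= n)%N -> u n = v n) -> seq_lim u l -> seq_lim v l.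
Proof.
move=> uv /seq_limP ul; apply/seq_limP => e /ul[M HM].
exists (maxn N M) => n; rewrite geq_max => /andP[leN leM].
by rewrite -uv // HM.
Qed.
End SeqLim.

(** * Unconditional sums and a two-way Tannery theorem *)

Section Tannery.
Variables (K : numFieldType) (I : choiceType) (F : I -> K).

Lemma has_sumP (l : K) : has_sum F l <->
  forall e, 0 < e -> exists S : seq I, forall T : seq I, uniq T ->
    {subset S <= T} -> `|\sum_(x <- T) F x - l| < e.
Proof.
have psE (A : {fset I}) : partial_sum F A = \sum_(x <- A) F x.
  by rewrite /partial_sum big_seq_fsetE.
have tF : Filter (@totally I) by have := @totally_filter I; case.
rewrite /has_sum; split=> [/cvgrPdist_lt H e e0|H].
  have [A _ HA] := H e e0; exists (enum_fset A) => T uT sAT.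
  rewrite distrC; have := HA [fset x in T]%fset; rewrite /= psE => HT.
  rewrite (perm_big (enum_fset [fset x in T]%fset)) /=; last first.
    by apply: uniq_perm => // x; rewrite inE.
  apply: HT; apply/fsubsetP => x xA; rewrite inE; exact: sAT.
apply/cvgrPdist_lt => e e0; have [S HS] := H e e0.
exists [fset x in S]%fset => // A /= /fsubsetP sSA.
rewrite psE distrC; apply: HS => // x xS; apply: sSA; by rewrite inE.
Qed.

(** Absolute summability as a Cauchy condition, meaningful before any sum is known to exist. *)
Definition small_tails : Prop :=
  forall e : K, 0 < e -> exists S : seq I, forall T : seq I, uniq T ->
    {in T, forall x, x \notin S} -> \sum_(x <- T) `|F x| < e.

Lemma big_subset_split (S T : seq I) (g : I -> K) :
  uniq S -> uniq T -> {subset S <= T} ->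
  \sum_(x <- T) g x =
  \sum_(x <- S) g x + \sum_(x <- [seq x <- T | x \notin S]) g x.
Proof.
move=> uS uT sST; rewrite (bigID (mem S)) /= -big_filter.
rewrite -[X in _ + X = _]big_filter; congr (_ + _).
apply: perm_big; apply: uniq_perm => //; first exact: filter_uniq.
by move=> x; rewrite mem_filter; apply: andb_idr; exact: sST.
Qed.

Variables (w : nat -> I -> K) (w0 C : K) (S : nat -> seq I).
Hypotheses (smallF : small_tails) (C_ge0 : 0 <= C) (w_le : forall M x, `|w M x| <= C).
Hypotheses (w_lim : forall x, seq_lim (w^~ x) w0).
Hypotheses (uniqS : forall M, uniq (S M)).
Hypotheses (exhS : forall x, exists N, forall M, (N <= M)%N -> x \in S M).

Lemma exhaust_subset (s : seq I) :
  exists N, forall M, (N <= M)%N -> {subset s <= S M}.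
Proof.
elim: s => [|x s [N HN]]; first by exists 0.
have [N' HN'] := exhS x; exists (maxn N N') => M.
rewrite geq_max => /andP[leN leN'] y; rewrite inE => /orP[/eqP ->|].
  exact: HN'.
exact: HN.
Qed.

(** Convergence of neither sum is assumed, so either limit can be deduced from the other. On a
    finite set [A] the weights converge pointwise; off [A] the tail of |F| controls both sums. *)
Lemma tannery_core e : 0 < e -> exists (A : seq I) (N : nat),
  forall M T, (N <= M)%N -> uniq T -> {subset A <= T} ->
  `|\sum_(x <- S M) w M x * F x - w0 * \sum_(x <- T) F x| < e.
Proof.
move=> e0.
have e20 : 0 < e / 2 by rewrite divr_gt0.
(* The tails enter with weights [C] and |w0|; the added 1 makes the divisor positive. *)
pose D := C + `|w0| + 1.
have D0 : 0 < D by rewrite ltr_wpDl // addr_ge0.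
have [A0 HA0] := smallF (divr_gt0 e20 D0).
pose A := undup A0; have uA : uniq A := undup_uniq A0.
have lim0 : seq_lim (fun M => \sum_(x <- A) (w M x - w0) * F x) 0.
  have z : \sum_(x <- A) (w0 - w0) * F x = 0.
    by rewrite big1 // => x _; rewrite subrr mul0r.
  rewrite -[X in seq_lim _ X]z.
  apply: (@seq_lim_sum _ _ _ (fun x M => (w M x - w0) * F x)) => x.
  apply: seq_limM (seq_lim_cst _).
  exact: seq_limD (w_lim x) (seq_lim_cst _).
have /seq_limP/(_ _ e20)[N1 HN1] := lim0.
have [N2 HN2] := exhaust_subset A.
exists A, (maxn N1 N2) => M T; rewrite geq_max => /andP[/HN1 h1 /HN2 h2] uT sAT.
rewrite (big_subset_split _ uA (uniqS M) h2) (big_subset_split _ uA uT sAT).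
set SM := [seq _ <- S M | _]; set TM := [seq _ <- T | _].
have tail_lt X : uniq X -> \sum_(x <- [seq x <- X | x \notin A]) `|F x| <= e / 2 / D.
  move=> uX; apply/ltW/HA0; first exact: filter_uniq.
  by move=> x; rewrite mem_filter mem_undup => /andP[].
rewrite (_ : _ - _ = \sum_(x <- A) (w M x - w0) * F x +
    (\sum_(x <- SM) w M x * F x - w0 * \sum_(x <- TM) F x)); last first.
  under [\sum_(x <- A) (_ - _) * _]eq_bigr do rewrite mulrBl.
  by rewrite sumrB -[\sum_(x <- A) w0 * F x]mulr_sumr; ring.
apply: le_lt_trans (ler_normD _ _) _; rewrite [ltRHS](splitr e).
rewrite subr0 in h1; apply: ltr_leD => //.
apply: le_trans (ler_normB _ _) _.
apply: (@le_trans _ _ (C * (e / 2 / D) + `|w0| * (e / 2 / D))).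
  apply: lerD.
    apply: le_trans (ler_norm_sum _ _ _) _.
    apply: le_trans (ler_wpM2l C_ge0 (tail_lt _ (uniqS M))).
    rewrite mulr_sumr; apply: ler_sum => x _; rewrite normrM.
    exact: ler_wpM2r.
  rewrite normrM; apply: ler_wpM2l => //.
  exact: le_trans (ler_norm_sum _ _ _) (tail_lt _ uT).
rewrite -mulrDl mulrCA -[leRHS]mulr1; apply: ler_wpM2l; first exact: ltW.
by rewrite ler_pdivrMr // mul1r lerDl.
Qed.

Lemma tannery_has_sum (l : K) : w0 != 0 ->
  seq_lim (fun M => \sum_(x <- S M) w M x * F x) l -> has_sum F (l / w0).
Proof.
move=> w00 /seq_limP wl; apply/has_sumP => e e0.
have w0p : 0 < `|w0| by rewrite normr_gt0.
have e20 : 0 < e * `|w0| / 2 by rewrite divr_gt0 // mulr_gt0.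
have [A [N HN]] := tannery_core e20; have [N' HN'] := wl _ e20.
exists A => T uT sAT; rewrite -(ltr_pM2r w0p) -normrM mulrBl divfK // mulrC.
have := HN (maxn N N') T (leq_maxl _ _) uT sAT.
have := HN' (maxn N N') (leq_maxr _ _).
set a := \sum_(x <- S _) _ => h1 h2.
rewrite (_ : _ - l = (a - l) - (a - w0 * \sum_(x <- T) F x)); last by ring.
by rewrite [ltRHS]splitr; apply: le_lt_trans (ler_normB _ _) (ltrD h1 h2).
Qed.

Lemma tannery_lim (l : K) : has_sum F l ->
  seq_lim (fun M => \sum_(x <- S M) w M x * F x) (w0 * l).
Proof.
move=> /has_sumP Fl; apply/seq_limP => e e0.
have e20 : 0 < e / 2 by rewrite divr_gt0.
have w1 : 0 < `|w0| + 1 by rewrite ltr_wpDl.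
have [A [N HN]] := tannery_core e20.
have [B HB] := Fl _ (divr_gt0 e20 w1).
exists N => M leNM; pose T := undup (A ++ B).
have h1 := HN M T leNM (undup_uniq _).
have h2 := HB T (undup_uniq _).
have {}h1 := h1 (fun x xA => ltac:(by rewrite mem_undup mem_cat xA)).
have {}h2 := h2 (fun x xB => ltac:(by rewrite mem_undup mem_cat xB orbT)).
set a := \sum_(x <- S _) _ in h1 *; set b := \sum_(x <- T) _ in h1 h2.
rewrite (_ : a - _ = (a - w0 * b) + w0 * (b - l)); last by ring.
apply: le_lt_trans (ler_normD _ _) _; rewrite [ltRHS](splitr e).
apply: ltr_leD => //; rewrite normrM.
apply: le_trans (ler_wpM2l _ (ltW h2)) _ => //.
rewrite mulrCA -[leRHS]mulr1; apply: ler_wpM2l; first exact: ltW.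
by rewrite ler_pdivrMr // mul1r lerDl.
Qed.
End Tannery.

Lemma seq_lim_bounded (K : numFieldType) (u : nat -> K) (l : K) :
  seq_lim u l -> exists2 E, 0 <= E & forall n, `|u n| <= E.
Proof.
move=> /seq_limP/(_ 1 ltr01)[N HN].
exists (\sum_(i < N) `|u i| + (1 + `|l|)); first by rewrite !addr_ge0 // sumr_ge0.
move=> n; have [ltnN|leNn] := ltnP n N.
  rewrite (bigD1 (Ordinal ltnN)) //= -addrA ler_wpDr // !addr_ge0 //.
  by rewrite sumr_ge0.
rewrite ler_wpDl ?sumr_ge0 //; rewrite -[u n](subrK l).
by apply: le_trans (ler_normD _ _) _; rewrite lerD2r ltW // HN.
Qed.

(** * Convergence and nonvanishing of infinite q-products over the complex numbers *)

Section ComplexLimits.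
Variable R : realType.
Implicit Types (a b r : R).
Local Notation C := (R[i])%type.
Local Open Scope complex_scope.

Lemma seq_lim_real (x : nat -> R) a :
  seq_lim x a -> seq_lim (fun n => (x n)%:C : C) a%:C.
Proof.
move=> /seq_limP xa; apply/seq_limP => e e0.
have eE : e = (complex.Re e)%:C.
  by case: e e0 => er ei; rewrite ltcE /= => /andP[/eqP ->].
have [N HN] : exists N, forall n, (N <= n)%N -> `|x n - a| < complex.Re e.
  by apply: xa; move: e0; rewrite eE ltcR.
by exists N => n /HN; rewrite eE -rmorphB /= normc_def /= expr0n addr0 sqrtr_sqr ltcR.
Qed.

Lemma geom_cauchy_real (x : nat -> R) b r : 0 <= b -> 0 <= r < 1 ->
  (forall n, `|x n.+1 - x n| <= b * r ^+ n) -> exists l, seq_lim x l.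
Proof.
move=> b0 /andP[r0 r1] hx.
have cx : cvgn (series (telescope x)).
  apply: normed_cvg; apply: (@series_le_cvg _ _ (geometric b r)).
  - by move=> n; exact: normr_ge0.
  - by move=> n; exact: geometric_ge0.
  - by move=> n; exact: hx.
  - by apply: is_cvg_geometric_series; rewrite ger0_norm.
exists (x 0%N + limn (series (telescope x))).
apply: (@eq_seq_lim _ (fun n => x 0%N + series (telescope x) n)).
  by move=> n; rewrite -eq_sum_telescope.
by apply: seq_limD; [exact: seq_lim_cst | split].
Qed.

Lemma geom_cauchy (x : nat -> C) b r : 0 <= b -> 0 <= r < 1 ->
  (forall n, `|x n.+1 - x n| <= (b * r ^+ n)%:C) -> exists l, seq_lim x l.
Proof.
move=> b0 r01 hx.
have Re_le (y : nat -> C) : (forall n, `|y n.+1 - y n| <= (b * r ^+ n)%:C) ->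
    forall n, `|complex.Re (y n.+1) - complex.Re (y n)| <= b * r ^+ n.
  move=> hy n; rewrite -lecR; apply: le_trans (hy n).
  by rewrite -raddfB; exact: normc_ge_Re.
have [l1 Hl1] := geom_cauchy_real b0 r01 (Re_le _ hx).
(* The real part of -i x is the imaginary part of x, so the real case applies a second time. *)
have hx' n : `|- 'i * x n.+1 - (- 'i * x n)| <= (b * r ^+ n)%:C.
  by rewrite -mulrBr normrM normrN normCi mul1r.
have [l2 Hl2] := geom_cauchy_real b0 r01 (Re_le _ hx').
exists (l1%:C + 'i * l2%:C).
apply: eq_seq_lim (seq_limD (seq_lim_real Hl1)
  (seq_limM (seq_lim_cst 'i) (seq_lim_real Hl2))) => n /=.
case: (x n) => s t; apply/eqP; rewrite eq_complex /=.
by apply/andP; split; apply/eqP; ring.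
Qed.

Lemma geom_sum_le r n : 0 <= r < 1 -> \sum_(k < n) r ^+ k <= (1 - r)^-1.
Proof.
move=> /andP[r0 r1]; have h : 0 < 1 - r by rewrite subr_gt0.
rewrite -[leRHS]mul1r ler_pdivlMr // mulrC.
have -> : (1 - r) * (\sum_(k < n) r ^+ k) = 1 - r ^+ n.
  by have := subrX1 r n; lra.
by rewrite lerBlDr lerDl exprn_ge0.
Qed.

Lemma prod1D_bounded b r : 0 <= b -> 0 <= r < 1 ->
  exists2 E, 0 <= E & forall n, \prod_(k < n) (1 + b * r ^+ k) <= E.
Proof.
move=> b0 r01; exists (expR (b / (1 - r))); first exact: expR_ge0.
have r0 : 0 <= r by case/andP: r01.
move=> n; apply: (@le_trans _ _ (\prod_(k < n) expR (b * r ^+ k))).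
  apply: ler_prod => k _; rewrite expR_ge1Dx andbT.
  by rewrite addr_ge0 // mulr_ge0 // exprn_ge0.
rewrite -expR_sum ler_expR -mulr_sumr; apply: ler_wpM2l => //.
exact: geom_sum_le.
Qed.

Lemma prod_near1_bounded (x : nat -> C) b r : 0 <= b -> 0 <= r < 1 ->
  (forall k, `|x k - 1| <= (b * r ^+ k)%:C) ->
  exists2 E, 0 <= E & forall n, `|\prod_(k < n) x k| <= E%:C.
Proof.
move=> b0 r01 hx; have [E E0 HE] := prod1D_bounded b0 r01; exists E => // n.
apply: (@le_trans _ _ (\prod_(k < n) (1 + b * r ^+ k))%:C); last by rewrite lecR.
rewrite normr_prod rmorph_prod; apply: ler_prod => k _; rewrite normr_ge0 /=.
rewrite -[x k](subrK 1) addrC; apply: le_trans (ler_normD _ _) _.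
by rewrite normr1 rmorphD lerD2l.
Qed.

Variable q : C.
Hypothesis hq : `|q| < 1.

Lemma norm_real : exists2 r, 0 <= r < 1 & `|q| = r%:C.
Proof.
exists (complex.Re `|q|); last by rewrite normc_def.
have := hq; have := normr_ge0 q; rewrite normc_def /=.
by rewrite lecR ltcR => -> ->.
Qed.

Lemma norm_realE (x : C) : exists2 b, 0 <= b & `|x| = b%:C.
Proof.
exists (complex.Re `|x|); last by rewrite normc_def.
by have := normr_ge0 x; rewrite normc_def /= lecR.
Qed.

Lemma qpoch_cvg (a : C) : exists l, seq_lim (qpoch a q) l.
Proof.
have [r r01 rE] := norm_real; have [b b0 bE] := norm_realE a.
have [|E E0 HE] := @prod_near1_bounded (fun k => 1 - a * q ^+ k) b r b0 r01.
  by move=> k; rewrite addrAC subrr sub0r normrN normrM normrX bE rE rmorphM rmorphXn.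
apply: (@geom_cauchy _ (E * b) r) => // [|n]; first exact: mulr_ge0.
rewrite qpochS mulrBr mulr1 addrAC subrr sub0r normrN !normrM normrX bE rE.
rewrite -mulrA rmorphM; apply: ler_pM => //; last by rewrite rmorphM rmorphXn.
  by rewrite mulr_ge0 ?exprn_ge0 // lecR //; case/andP: r01.
exact: HE.
Qed.

(** The powers are geometrically Cauchy, and their limit satisfies l = q l with q different from
    1. *)
Lemma qexp_cvg0 : seq_lim (fun n => q ^+ n) 0.
Proof.
have [r r01 rE] := norm_real; have [b b0 bE] := norm_realE (q - 1).
have [|l Hl] := @geom_cauchy (fun n => q ^+ n) b r b0 r01.
  move=> n; rewrite exprS -{2}[q ^+ n]mul1r -mulrBl normrM normrX bE rE.
  by rewrite rmorphM rmorphXn.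
suff -> : 0 = l by [].
have H : l = q * l.
  apply: (@seq_lim_unique _ (fun n => q ^+ n.+1)).
    by apply: seq_lim_sub Hl => N; exists N => n; exact: leqW.
  by apply: eq_seq_lim (seq_limM (seq_lim_cst q) Hl) => n; rewrite exprS.
have : (1 - q) * l == 0 by rewrite mulrBl mul1r -H subrr.
rewrite mulf_eq0 => /orP[/eqP/subr0_eq q1|/eqP -> //].
by move: hq; rewrite -q1 normr1 ltxx.
Qed.

(** The reciprocal factors converge to 1, hence are bounded; so 1/(1 - a q^k) - 1 = a q^k / (1 - a
    q^k) decays geometrically and [prod_near1_bounded] applies. *)
Lemma qpochV_bounded (a : C) : (forall k, 1 - a * q ^+ k != 0) ->
  exists2 E : C, 0 <= E & forall n, `|(qpoch a q n)^-1| <= E.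
Proof.
move=> nz; have [r r01 rE] := norm_real; have [b b0 bE] := norm_realE a.
have lim1 : seq_lim (fun k => 1 - a * q ^+ k) 1.
  have e1 : 1 + - a * 0 = 1 by rewrite mulr0 addr0.
  rewrite -[X in seq_lim _ X]e1.
  apply: eq_seq_lim (seq_limD (seq_lim_cst 1)
    (seq_limM (seq_lim_cst (- a)) qexp_cvg0)) => k /=.
  by rewrite mulNr.
have [D D0 HD] := seq_lim_bounded (seq_limV (oner_neq0 _) lim1).
have [d d0 dE] := norm_realE D; rewrite ger0_norm // in dE.
have [||E E0 HE] := @prod_near1_bounded (fun k => (1 - a * q ^+ k)^-1) (d * b) r _ r01.
- exact: mulr_ge0.
- move=> k; rewrite (_ : _ - 1 = (1 - a * q ^+ k)^-1 * (a * q ^+ k)); last first.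
    by field; exact: nz.
  have -> : (d * b * r ^+ k)%:C = D * (b * r ^+ k)%:C.
    by rewrite -mulrA rmorphM dE.
  rewrite normrM normrM normrX bE rE.
  apply: ler_pM => //; last by rewrite rmorphM rmorphXn.
  by rewrite mulr_ge0 ?exprn_ge0 // lecR //; case/andP: r01.
exists E%:C; first by rewrite lecR.
by move=> n; rewrite /qpoch -prodfV.
Qed.

Lemma qpoch_lim_neq0 (a l : C) : (forall k, 1 - a * q ^+ k != 0) ->
  seq_lim (qpoch a q) l -> l != 0.
Proof.
move=> nz Hl; have [E E0 HE] := qpochV_bounded nz; apply/eqP => l0.
have nzp n : qpoch a q n != 0 by apply/prodf_neq0 => k _.
have /seq_limP/(_ (E + 1)^-1) := Hl; rewrite l0 invr_gt0 ltr_wpDl // => /(_ isT)[N HN].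
have := HN N (leqnn N); rewrite subr0.
have E1 : 0 < E + 1 by rewrite ltr_wpDl.
rewrite -{1}[X in X < _]invrK ltf_pV2 ?posrE // -?normfV => [h|].
  by have := lt_le_trans h (HE N); rewrite gtrDl ltr10.
by rewrite normr_gt0 invr_eq0.
Qed.

End ComplexLimits.

(** A finite set whose sum of norms comes within e of the supremum leaves less than e for any set
    disjoint from it. *)
Lemma small_tails_bounded (R : realType) (I : choiceType) (F : I -> R[i]) (B : R) :
  (forall T : seq I, uniq T -> \sum_(x <- T) `|F x| <= (B%:C)%C) -> small_tails F.
Proof.
move=> HB e e0.
pose G x := complex.Re `|F x|.
have GE T : \sum_(x <- T) `|F x| = ((\sum_(x <- T) G x)%:C)%C.
  by rewrite rmorph_sum; apply: eq_bigr => x _; rewrite /G normc_def.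
have eE : e = ((complex.Re e)%:C)%C.
  by case: e e0 => er ei; rewrite ltcE /= => /andP[/eqP ->].
pose E := [set \sum_(x <- T) G x | T in [set T : seq I | uniq T]].
have supE : has_sup E.
  split; first by exists (\sum_(x <- [::]) G x); exists [::].
  by exists B => _ [T /= uT <-]; have := HB T uT; rewrite GE lecR.
have er0 : 0 < complex.Re e by move: e0; rewrite eE ltcR.
have [_ [S /= uS <-] hS] := sup_adherent er0 supE.
exists S => T uT dT; rewrite GE eE ltcR.
have : \sum_(x <- S ++ T) G x <= sup E.
  apply: ub_le_sup; first by case: supE.
  exists (S ++ T) => //=; rewrite cat_uniq uS uT andbT /=.
  by apply/hasPn => x /dT.
rewrite big_cat /=; lra.
Qed.

(** * The quintuple product *)

Definition zwin (B : nat) : seq int :=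
  [seq Posz i | i <- iota 0 B] ++ [seq Negz i | i <- iota 0 B].

Lemma zwin_uniq B : uniq (zwin B).
Proof.
rewrite cat_uniq !map_inj_uniq ?iota_uniq ?andbT => [|i j []//|i j []//].
by apply/hasPn => _ /mapP[i _ ->]; apply/negP => /mapP[].
Qed.

Lemma mem_zwin B (j : int) : (`|j| < B)%N -> j \in zwin B.
Proof.
rewrite mem_cat; case: j => n hn; apply/orP; [left|right].
  by apply/mapP; exists n => //; rewrite mem_iota.
by apply/mapP; exists n => //; rewrite mem_iota; lia.
Qed.

Lemma zwin_exhaust (e : nat -> nat) : (forall M, (M <= e M)%N) ->
  forall j : int, exists N, forall M, (N <= M)%N -> j \in zwin (e M).
Proof.
move=> le j; exists `|j|.+1 => M ltM; apply: mem_zwin.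
exact: leq_trans ltM (le M).
Qed.

Lemma big_zwin (K : numFieldType) B (f : int -> K) :
  \sum_(j <- zwin B) f j = zsum B f.
Proof.
rewrite big_cat !big_map /zsum big_split /=.
have h : iota 0 B = index_iota 0 B by rewrite /index_iota subn0.
by rewrite h !big_mkord.
Qed.

Lemma ler_sum_uniq (K : numFieldType) (I : choiceType) (S T : seq I) (g : I -> K) :
  (forall x, 0 <= g x) -> uniq S -> uniq T -> {subset T <= S} ->
  \sum_(x <- T) g x <= \sum_(x <- S) g x.
Proof.
by move=> g0 uS uT sTS; rewrite (big_subset_split g uT uS sTS) lerDl sumr_ge0.
Qed.

(** The window -3M-1 <= j <= 3M pairs j = -3k with j = -3k-1 for -M <= k <= M; the term outside
    [zsum M] is k = M. The sign in -3k is the one required by [quint_coefE]. *)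
Lemma zsum_coef3 (K : numFieldType) M (G : int -> K) :
  zsum (3 * M).+1 (fun j => coef3 j * G j) =
  zsum M (fun k => G (- 3 * k) - G (- 3 * k - 1))
  + (G (- 3 * M%:Z) - G (- 3 * M%:Z - 1)).
Proof.
elim: M => [|M IH].
  rewrite muln0 zsumS /zsum !big_ord0 !add0r.
  have -> : coef3 (Posz 0) = 1 :> K by [].
  have -> : coef3 (Negz 0) = -1 :> K by [].
  by rewrite mul1r mulN1r; congr (G _ - G _); lia.
rewrite (_ : (3 * M.+1).+1 = (3 * M).+4); last lia.
rewrite [zsum (3 * M).+4 _]zsumS [zsum (3 * M).+3 _]zsumS [zsum (3 * M).+2 _]zsumS.
rewrite IH [zsum M.+1 _]zsumS.
have -> : Posz (3 * M).+1 = 3 * M%:Z + 1 by lia.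
have -> : Posz (3 * M).+2 = 3 * M%:Z + 2 by lia.
have -> : Posz (3 * M).+3 = 3 * (M%:Z + 1) by lia.
have -> : Negz (3 * M).+1 = 3 * (- M%:Z - 1) + 1 by lia.
have -> : Negz (3 * M).+2 = 3 * (- M%:Z - 1) by lia.
have -> : Negz (3 * M).+3 = 3 * (- M%:Z - 2) + 2 by lia.
rewrite !(coef3_0, coef3_1, coef3_2).
have -> : - 3 * Negz M = 3 * (M%:Z + 1) by lia.
have -> : 3 * (M%:Z + 1) - 1 = 3 * M%:Z + 2 by lia.
have -> : - 3 * M.+1%:Z = 3 * (- M%:Z - 1) by lia.
have -> : 3 * (- M%:Z - 1) - 1 = 3 * (- M%:Z - 2) + 2 by lia.
ring.
Qed.

Lemma sum_center (K : numFieldType) M (h : int -> K) :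
  \sum_(i < (2 * M).+1) h (i%:Z - M%:Z) = zsum M h + h M.
Proof.
elim: M => [|M IH]; first by rewrite big_ord1 /zsum big_ord0 !add0r oppr0.
rewrite (_ : (2 * M.+1).+1 = (2 * M).+3); last lia.
rewrite big_ord_recl big_ord_recr /= zsumS.
rewrite (_ : \sum_(i < (2 * M).+1) _ = zsum M h + h M); last first.
  by rewrite -IH; apply: eq_bigr => i _; congr h; rewrite /bump /=; lia.
have -> : Negz M = 0%:Z - M.+1%:Z by lia.
have -> : (bump 0 (2 * M).+1)%:Z - M.+1%:Z = M.+1 by rewrite /bump; lia.
ring.
Qed.

Lemma qpoch_double (K : numFieldType) (x Q : K) n :
  qpoch x Q (2 * n) = qpoch x (Q ^+ 2) n * qpoch (x * Q) (Q ^+ 2) n.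
Proof.
elim: n => [|n IH]; first by rewrite muln0 !qpoch0 mulr1.
rewrite (_ : (2 * n.+1 = (2 * n).+2)%N); last lia.
by rewrite !qpochS IH -!exprM [Q ^+ (2 * n).+1]exprS; ring.
Qed.

Lemma qpoch_sqr (K : numFieldType) (y Q : K) n :
  qpoch (y ^+ 2) (Q ^+ 2) n = qpoch y Q n * qpoch (- y) Q n.
Proof.
elim: n => [|n IH]; first by rewrite !qpoch0 mulr1.
rewrite !qpochS IH -exprM mulnC exprM; ring.
Qed.

Lemma seq_lim_shift (K : numFieldType) (v : nat -> K) l (j : int) :
  seq_lim v l -> seq_lim (fun M => v `|(M%:Z + j)%R|%N) l.
Proof.
apply: (seq_lim_sub (f := fun M => `|(M%:Z + j)%R|%N)) => N {v l}.
by exists (N + `|j|)%N => n; clear; lia.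
Qed.

Lemma inv_qpoch_lim (K : numFieldType) (q : K) l (j : int) :
  l != 0 -> seq_lim (qpoch q q) l ->
  seq_lim (fun M => inv_qpoch q (M%:Z + j)) l^-1.
Proof.
move=> l0 ql; apply: (@seq_lim_near _ _ _ _ `|j| _ (seq_lim_shift j (seq_limV l0 ql))).
move=> M leM; have -> : M%:Z + j = `|(M%:Z + j)%R|%N by lia.
by [].
Qed.

Section InvQpoch.
Variables (R : realType) (q : R[i]).
Hypotheses (hq : `|q| < 1) (q_neq0 : q != 0).
Local Notation u := (inv_qpoch q).

Lemma qz_neq1 (e : int) : e != 0 -> q ^ e != 1.
Proof.
have h n : q ^+ n.+1 != 1.
  apply/eqP => /(congr1 Num.norm); rewrite normrX normr1 => h.
  by have := exprn_ilt1 n.+1 (normr_ge0 q) hq; rewrite h ltxx.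
case: e => [[//|n]|n] _; first exact: h.
by rewrite NegzE -invr_expz -exprnP invr_eq1.
Qed.

Lemma q_nroot n : q ^+ n.+1 != 1.
Proof. exact: (@qz_neq1 n.+1). Qed.

Lemma inv_qpoch_bounded : exists2 E, 0 <= E & forall n : int, `|u n| <= E.
Proof.
have [|E E0 HE] := @qpochV_bounded _ q hq q.
  by move=> k; apply: qfactor_neq0; exact: q_nroot.
by exists E => // -[n|n]; [exact: HE | rewrite /inv_qpoch normr0].
Qed.
End InvQpoch.

(** * Absolute convergence of the theta series *)

Section Theta.
Variables (R : realType) (q : R[i]) (f s : nat).
Hypotheses (hq : `|q| < 1) (hs : (s <= f)%N).

Definition theta_term (j : int) : R[i] := coef3 j * q ^ cexp f s j.

(** For negative j the square absorbs the linear term because s <= f; growth at least |j| then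
    allows comparison with a geometric series. *)
Lemma cexp_ge (j : int) : exists2 n : nat, cexp f s j = n & (`|j| <= n)%N.
Proof.
have [d fE] : exists d, f = (s + d)%N by exists (f - s)%N; rewrite subnKC.
rewrite /cexp fE; case: j => n.
  by exists ((s + d).+1 * (n * n) + s * n)%N; [lia | nia].
exists (d.+1 * (n.+1 * n.+1) + s * (n.+1 * n))%N; last nia.
by rewrite NegzE; lia.
Qed.

Lemma theta_term_le (j : int) : `|theta_term j| <= `|q| ^+ `|j|.
Proof.
have [n nE len] := cexp_ge j; rewrite /theta_term normrM nE.
have c1 : `|coef3 j : R[i]| <= 1.
  by rewrite /coef3; case: ifP => _; [|case: ifP => _]; rewrite ?normrN ?normr1 ?normr0.
rewrite -exprnP normrX -[leRHS]mul1r; apply: ler_pM => //.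
  by rewrite exprn_ge0.
by apply: ler_wiXn2l => //; exact: ltW.
Qed.

Lemma theta_small : small_tails theta_term.
Proof.
have [r r01 rE] := norm_real hq.
apply: (@small_tails_bounded _ _ _ ((1 - r)^-1 + (1 - r)^-1)) => T uT.
pose B := (\max_(j <- T) `|j|).+1.
apply: (@le_trans _ _ (\sum_(j <- zwin B) `|q| ^+ `|j|)).
  apply: (@le_trans _ _ (\sum_(j <- T) `|q| ^+ `|j|)).
    by apply: ler_sum => j _; exact: theta_term_le.
  apply: ler_sum_uniq => //; first by move=> j; rewrite exprn_ge0.
    exact: zwin_uniq.
  by move=> j jT; apply: mem_zwin; rewrite ltnS; apply: leq_bigmax_seq.
rewrite big_zwin /zsum big_split /= rE rmorphD; apply: lerD.
  under eq_bigr do rewrite -rmorphXn.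
  by rewrite -rmorph_sum lecR geom_sum_le.
apply: (@le_trans _ _ ((\sum_(k < B) r ^+ k)%:C)%C); last by rewrite lecR geom_sum_le.
rewrite rmorph_sum; apply: ler_sum => k _; rewrite -rmorphXn lecR.
by case/andP: r01 => r0 r1; apply: ler_wiXn2l => //; exact: ltW.
Qed.
End Theta.

Lemma centered_index (i M : nat) (k : int) :
  (i < (2 * M).+1)%N -> k = i%:Z - M%:Z ->
  [/\ M%:Z + k = i, M%:Z + (k + 1) = i.+1, M%:Z - k = (2 * M - i)%N
    & (2 * M)%:Z - i%:Z = (2 * M - i)%N].
Proof. by split; lia. Qed.

Section ThetaSum.
Variables (R : realType) (q : R[i]) (f s : nat).
Hypotheses (hq : `|q| < 1) (q_neq0 : q != 0) (hs : (s <= f)%N).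
Let qzD := qzD q_neq0.
Let Q := q ^+ (6 * (f + 1)).
Let y := q ^+ (f + 1 - s).

Lemma norm_qexp_lt1 n : (0 < n)%N -> `|q ^+ n| < 1.
Proof. by move=> n0; rewrite normrX exprn_ilt1 // -lt0n. Qed.

Let Q_neq0 : Q != 0. Proof. exact: expf_neq0. Qed.
Let y_neq0 : y != 0. Proof. exact: expf_neq0. Qed.
Let hQ : `|Q| < 1. Proof. by apply: norm_qexp_lt1; lia. Qed.

(** The total exponent 6(f+1)e + 2(f+1-s) cannot vanish, since 0 < 2(f+1-s) < 6(f+1). *)
Lemma theta_nonroot (e : int) : 1 - Q ^ e * (- y) ^+ 2 != 0.
Proof.
rewrite sqrrN subr_eq0 eq_sym /Q /y !exprnP !exprz_exp -qzD.
apply: qz_neq1 => //.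
have [e0|e0] : 0 <= e \/ e + 1 <= 0 by lia.
  have : 0 <= (f + 1)%:Z * e by rewrite mulr_ge0.
  lia.
have : (f + 1)%:Z * (e + 1) <= 0 by rewrite mulr_ge0_le0.
lia.
Qed.

Lemma quint_coefE (k : int) : quint_coef Q (- y) k =
  q ^ cexp f s (- 3 * k) - q ^ cexp f s (- 3 * k - 1).
Proof.
rewrite /quint_coef -[- y]mulN1r expfzMl.
have sgn : (-1) ^ k * (-1) ^ (3 * k) = 1 :> R[i].
  rewrite -expfzDr ?oppr_eq0 ?oner_eq0 //.
  have -> : k + 3 * k = 2%:Z * (2 * k) by lia.
  by rewrite -exprz_exp -exprnP sqrrN expr1n exp1rz.
rewrite [_ ^ k * _]mulrA sgn mul1r /Q /y !exprnP !exprz_exp mulrDr mulr1.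
rewrite -[-1 * _ * _]mulrA [-1 * (q ^ _ * _)]mulN1r mulrN -!qzD.
congr (q ^ _ - q ^ _); rewrite /cexp.
  by have := tri2 k; lia.
by have := tri2 k; lia.
Qed.

(** The limit of [quint_finite] gives (Q;Q)(z^2;Q)(Q/z^2;Q) / ((z;Q)(Q/z;Q)), all products infinite.
    Splitting the squared arguments into base Q^2 by [qpoch_double] and [qpoch_sqr] cancels the
    denominator and leaves the products in y. *)
Lemma theta_has_sum LQ ly lyq lA lB :
  seq_lim (qpoch Q Q) LQ -> seq_lim (qpoch y Q) ly ->
  seq_lim (qpoch (Q / y) Q) lyq ->
  seq_lim (qpoch (y ^+ 2 * Q) (Q ^+ 2)) lA ->
  seq_lim (qpoch (Q / y ^+ 2) (Q ^+ 2)) lB ->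
  has_sum (theta_term q f s) (ly * lyq * LQ * (lA * lB)).
Proof.
have le3 M : (M <= (3 * M).+1)%N by lia.
move=> HQ Hy Hyq HA HB; pose z := - y.
have z0 : z != 0 by rewrite oppr_eq0.
have zz : z ^+ 2 = y ^+ 2 by rewrite sqrrN.
have Q_nroot := q_nroot hQ.
have nz := theta_nonroot.
have LQ0 : LQ != 0.
  by apply: (qpoch_lim_neq0 hQ _ HQ) => k; exact: qfactor_neq0.
have [lz Hz] := qpoch_cvg hQ z; have [lqz Hqz] := qpoch_cvg hQ (Q / z).
have [lz2 Hz2] := qpoch_cvg hQ (z ^+ 2).
have [lqz2 Hqz2] := qpoch_cvg hQ (Q / z ^+ 2).
have nz1 k : 1 - z ^+ 2 * Q ^+ k != 0 by rewrite mulrC exprnP nz.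
have nz2 k : 1 - Q / z ^+ 2 * Q ^+ k != 0.
  have := @qpoch_sqrV_neq0 _ _ Q_neq0 z k.+1 z0 nz.
  by rewrite qpochS mulf_eq0 negb_or => /andP[].
have lz20 : lz2 != 0 := qpoch_lim_neq0 hQ nz1 Hz2.
have lqz20 : lqz2 != 0 := qpoch_lim_neq0 hQ nz2 Hqz2.
have sub2 (v : nat -> R[i]) l : seq_lim v l -> seq_lim (fun n => v (2 * n)%N) l.
  by apply: (seq_lim_sub (f := fun n => (2 * n)%N)) => N; exists N => n; lia.
have lz2E : lz2 = ly * lz * lA.
  apply: seq_lim_unique (sub2 _ _ Hz2) _.
  apply: eq_seq_lim _ (seq_limM (seq_limM Hy Hz) HA) => n /=.
  by rewrite qpoch_double zz qpoch_sqr.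
have lqz2E : lqz2 = lyq * lqz * lB.
  apply: seq_lim_unique (sub2 _ _ Hqz2) _.
  apply: eq_seq_lim _ (seq_limM (seq_limM Hyq Hqz) HB) => n /=.
  rewrite qpoch_double zz (_ : Q / y ^+ 2 * Q = (Q / y) ^+ 2); last first.
    by field.
  by rewrite qpoch_sqr [RHS]mulrC /z invrN mulrN.
pose W M (k : int) : R[i] := inv_qpoch Q (M%:Z + - k) * inv_qpoch Q (M%:Z + k)
  * (qpoch (z ^+ 2) Q `|(M%:Z + (k + 1))%R|%N)^-1
  * (qpoch (Q / z ^+ 2) Q `|(M%:Z + - k)%R|%N)^-1.
have [E E0 HE] := inv_qpoch_bounded hQ.
have [E1 E10 HE1] := qpochV_bounded hQ nz1.
have [E2 E20 HE2] := qpochV_bounded hQ nz2.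
(* Both j = -3k and j = -3k-1 receive the weight of index k; the remaining residue class has
   coefficient 0. *)
pose w M (j : int) := W M (- j %/ 3)%Z.
pose w0 := LQ^-1 * LQ^-1 * lz2^-1 * lqz2^-1.
have w00 : w0 != 0 by rewrite !mulf_neq0 // invr_eq0.
have wl : seq_lim (fun M => \sum_(j <- zwin (3 * M).+1) w M j * theta_term q f s j)
    (LQ^-1 * (lz * lqz)^-1).
  have lzn0 : lz * lqz != 0.
    apply/eqP => h; have : lz2 * lqz2 = 0.
      by rewrite lz2E lqz2E -[RHS](mulr0 (ly * lA * lyq * lB)) -h; ring.
    by apply/eqP; rewrite mulf_neq0.
  apply: eq_seq_lim _ (seq_limM (sub2 _ _ (seq_limV LQ0 HQ))
    (seq_limV lzn0 (seq_limM (seq_lim_sub (f := S) _ Hz) Hqz))); last first.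
    by move=> N; exists N => n; exact: leqW.
  move=> M; rewrite big_zwin.
  transitivity (zsum (3 * M).+1 (fun j => coef3 j *
    (w M j * q ^ cexp f s j))); last first.
    by apply: eq_zsum => j; rewrite /theta_term; ring.
  rewrite zsum_coef3.
  rewrite -(@sum_center _ M
    (fun k => w M (- 3 * k) * _ - w M (- 3 * k - 1) * _)).
  rewrite -[LHS](@quint_finite _ _ Q_neq0 Q_nroot z M z0 nz).
  apply: eq_bigr => -[i lei] _ /=.
  have [k kE] : exists k, k = i%:Z - M%:Z by exists (i%:Z - M%:Z).
  rewrite -kE.
  have -> : w M (- 3 * k) = W M k.
    rewrite /w (_ : - (- 3 * k) = k * 3 + 0); last by ring.
    by rewrite divzMDl // div0z addr0.
  have -> : w M (- 3 * k - 1) = W M k.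
    rewrite /w (_ : - (- 3 * k - 1) = k * 3 + 1); last by ring.
    by rewrite divzMDl // (_ : (1 %/ 3)%Z = 0) ?addr0.
  rewrite -mulrBr -quint_coefE -/z /W.
  by have [-> -> -> ->] := centered_index lei kE; rewrite !absz_nat invfM; ring.
have := @tannery_has_sum _ _ (theta_term q f s) w w0 (E * E * E1 * E2)
  (fun M => zwin (3 * M).+1) (theta_small hq hs) _ _ _ _ _ _ w00 wl.
rewrite (_ : ly * _ * _ * _ = LQ^-1 * (lz * lqz)^-1 / w0); last first.
  rewrite /w0 lz2E lqz2E; field.
  move: lz20 lqz20; rewrite lz2E lqz2E !mulf_eq0 !negb_or LQ0.
  by move=> /andP[/andP[-> ->] ->] /andP[/andP[-> ->] ->].
apply.
- by rewrite !mulr_ge0.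
- move=> M j; rewrite /w /W !normrM; 
  apply: ler_pM; [by rewrite !mulr_ge0 | by [] | | exact: HE2].
  apply: ler_pM; [by rewrite !mulr_ge0 | by [] | | exact: HE1].
  by apply: ler_pM; [ | | exact: HE | exact: HE].
- move=> j; pose k : int := (- j %/ 3)%Z.
  have H := (seq_limM (seq_limM (seq_limM (inv_qpoch_lim (- k) LQ0 HQ)
    (inv_qpoch_lim k LQ0 HQ)) (seq_lim_shift (k + 1) (seq_limV lz20 Hz2)))
    (seq_lim_shift (- k) (seq_limV lqz20 Hqz2))).
  by apply: eq_seq_lim _ H.
- by move=> M; exact: zwin_uniq.
- exact: zwin_exhaust le3.
Qed.
End ThetaSum.

(** * The multisum *)

Lemma part_cons f n (t : f.-tuple nat) i :
  part (cons_tuple n t) i.+2 = part t i.+1.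
Proof. by []. Qed.

Lemma tail_sum_cons f n (t : f.-tuple nat) i :
  tail_sum (cons_tuple n t) i.+2 = tail_sum t i.+1.
Proof. by rewrite /tail_sum big_add1 [RHS]big_add1 big_add1. Qed.

Lemma tail_sum1 f (t : f.-tuple nat) : tail_sum t 1 = sumn t.
Proof.
by rewrite /tail_sum /part big_add1 /= sumnE [RHS](big_nth 0%N) size_tuple.
Qed.

(** The parameter s stays fixed while the tuple shrinks, so it may exceed the number of parts;
    truncated subtraction then makes the range start at 1, which includes the new N_1. *)
Lemma lin_range_cons f s n (t : f.+1.-tuple nat) :
  (\sum_(f.+2 - s + 1 <= i < f.+3) tail_sum (cons_tuple n t) i =
   (f.+1 < s) * (n + sumn t) + \sum_(f.+1 - s + 1 <= i < f.+2) tail_sum t i)%N.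
Proof.
have sh k : (\sum_(k.+2 <= i < f.+3) tail_sum (cons_tuple n t) i =
    \sum_(k.+1 <= i < f.+2) tail_sum t i)%N.
  rewrite big_add1 [RHS]big_add1 big_add1 /=; apply: eq_bigr => i _.
  exact: tail_sum_cons.
have [les|lts] := leqP s f.+1.
  rewrite mul0n add0n !addn1 subSn //; exact: sh.
rewrite mul1n !addn1.
have -> : (f.+2 - s = 0)%N by apply/eqP; rewrite subn_eq0.
have -> : (f.+1 - s = 0)%N by apply/eqP; rewrite subn_eq0 ltnW.
by rewrite big_ltn // sh tail_sum1.
Qed.

Section Multisum.
Variables (K : numFieldType) (q : K).
Local Notation u := (inv_qpoch q).

Fixpoint hterm (s : nat) (l : seq nat) : K :=
  if l is n :: l' then
    q ^+ (sumn l ^ 2 + (size l' < s)%N * sumn l) *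
    (if l' is [::] then qpoch q q n * u (2 * n)%N else u n * hterm s l')
  else 0.

Lemma hterm_tuple f s (t : f.+1.-tuple nat) :
  q ^+ (\sum_(1 <= i < f.+2) tail_sum t i ^ 2
        + \sum_(f.+1 - s + 1 <= i < f.+2) tail_sum t i)
    * qpoch q q (part t f.+1)
    / ((\prod_(1 <= i < f.+1) qpoch q q (part t i))
       * qpoch q q (2 * part t f.+1)) = hterm s t.
Proof.
elim: f t => [|f IH] t; case/tupleP: t => n t.
  rewrite tuple0 /= big_nat1 tail_sum1 /= addn0.
  rewrite [X in _ / (X * _)]big_geq // mul1r.
  have -> : (\sum_(1 - s + 1 <= i < 2) tail_sum [tuple n] i = (0 < s) * n)%N.
    case: s => [|s]; first by rewrite big_geq.
    by rewrite subSS sub0n big_nat1 tail_sum1 /= addn0 mul1n.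
  by rewrite mulrA.
have -> : (\sum_(1 <= i < f.+3) tail_sum (cons_tuple n t) i ^ 2 =
    (n + sumn t) ^ 2 + \sum_(1 <= i < f.+2) tail_sum t i ^ 2)%N.
  rewrite big_ltn // tail_sum1 big_add1 /= big_add1 [in RHS]big_add1 /=.
  by congr addn; apply: eq_bigr => i _; rewrite tail_sum_cons.
have -> : \prod_(1 <= i < f.+2) qpoch q q (part (cons_tuple n t) i) =
    qpoch q q n * \prod_(1 <= i < f.+1) qpoch q q (part t i).
  rewrite big_ltn // big_add1 /= big_add1 [in RHS]big_add1 /=.
  by congr (_ * _); apply: eq_bigr => i _; rewrite part_cons.
rewrite lin_range_cons part_cons.
set X := (\sum_(_ <= i < _) _ ^ 2)%N; set Y := (\sum_(_ <= i < _) _)%N.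
rewrite [hterm s _]/= size_tuple.
have -> : (if tval t is [::] then qpoch q q n * u (2 * n)%N else u n * hterm s t)
    = u n * hterm s t by case: t {IH X Y} => -[].
rewrite -IH -/X -/Y -[u n]/((qpoch q q n)^-1).
have -> : ((n + sumn t) ^ 2 + X + ((f.+1 < s) * (n + sumn t) + Y) =
  (n + sumn t) ^ 2 + (f.+1 < s) * (n + sumn t) + (X + Y))%N by lia.
by rewrite [in LHS]exprD !invfM; ring.
Qed.

Lemma multisum_termE f s (m n : nat) (t : f.+1.-tuple nat) :
  q ^+ (2 * m ^ 2 + 6 * m * n + 6 * n ^ 2
        + \sum_(1 <= i < f.+2) tail_sum t i ^ 2
        + \sum_(f.+1 - s + 1 <= i < f.+2) tail_sum t i)%N
  * qpoch q q (part t f.+1)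
  / (qpoch q q m * qpoch (q ^+ 3) (q ^+ 3) n
     * (\prod_(1 <= i < f.+1) qpoch q q (part t i))
     * qpoch q q (2 * part t f.+1)%N)
  * u ((part t f.+1)%:Z - 3%:Z * n%:Z - 2%:Z * m%:Z) =
  dterm q m n * u ((part t f.+1)%:Z - (2 * m + 3 * n)%:Z) * hterm s t.
Proof.
rewrite -hterm_tuple /dterm.
have -> : (part t f.+1)%:Z - 3%:Z * n%:Z - 2%:Z * m%:Z =
  (part t f.+1)%:Z - (2 * m + 3 * n)%:Z by lia.
by rewrite -addnA exprD !invfM; ring.
Qed.

Lemma hterm_cterm (q_neq0 : q != 0) (q_nroot : forall n, q ^+ n.+1 != 1)
    B s f (t : f.+1.-tuple nat) : (part t f.+1 < B)%N ->
  dconv q B (part t f.+1) * hterm s t = cterm q B s t.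
Proof.
elim: f t => [|f IH] t; case/tupleP: t => n t.
  rewrite tuple0 /part /= => ltnB.
  have := dconv_gsum q_neq0 q_nroot ltnB; set d := dconv _ _ _ => E.
  rewrite -[u _]/((qpoch q q (2 * n))^-1).
  transitivity (q ^+ ((n + 0) ^ 2 + (0 < s) * (n + 0)) *
    (qpoch q q n * d / qpoch q q (2 * n))); first by ring.
  by rewrite E mulrAC mulfV ?mul1r // qpoch_neq0.
rewrite part_cons => /IH E; rewrite /=.
by case: t E => -[|m l] //= sz E; rewrite -E; ring.
Qed.
End Multisum.

(** * Exhausting boxes and absolute convergence of the multisum *)

Lemma tbox_uniq B f : uniq (tbox B f).
Proof.
elim: f => [|f IH] //=; apply: allpairs_uniq => //; first exact: iota_uniq.
move=> [m t] [n t'] _ _ /= /(congr1 val) /= [-> tt'].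
by congr pair; exact: val_inj.
Qed.

Lemma mem_tbox B f (t : f.-tuple nat) : (t \in tbox B f) = all (ltn^~ B) t.
Proof.
elim: f t => [|f IH] t; first by rewrite tuple0.
case/tupleP: t => n t; rewrite [RHS]/= -IH.
apply/allpairsP/andP => [[[m t'] /= [hm ht' E]]|[hn ht]]; last first.
  by exists (n, t); rewrite mem_index_iota hn.
have [-> tt'] := congr1 val E; rewrite mem_index_iota in hm; split=> //.
by rewrite (_ : t = t') //; exact: val_inj.
Qed.

Definition mbox f B : seq (nat * nat * f.-tuple nat) :=
  [seq (p, t) | p <- [seq (m, n) | m <- index_iota 0 B, n <- index_iota 0 B],
                t <- tbox B f].

Lemma mbox_uniq f B : uniq (mbox f B).
Proof.
apply: allpairs_uniq => [||[p t] [p' t'] _ _ //].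
  apply: allpairs_uniq => [||[p t] [p' t'] _ _ //]; exact: iota_uniq.
exact: tbox_uniq.
Qed.

Lemma mbox_exhaust f (x : nat * nat * f.-tuple nat) :
  exists N, forall M, (N <= M)%N -> x \in mbox f M.+1.
Proof.
case: x => -[m n] t; exists (m + n + sumn t)%N => M leM.
have [lem [len let_]] : (m < M.+1 /\ n < M.+1 /\ sumn t < M.+1)%N by lia.
apply: allpairs_f; first by apply: allpairs_f; rewrite mem_index_iota.
rewrite mem_tbox; apply/allP => i it; apply: leq_ltn_trans let_.
by rewrite sumnE (big_rem i) //= leq_addr.
Qed.

Lemma big_mbox (V : zmodType) f B (F : nat * nat * f.-tuple nat -> V) :
  \sum_(x <- mbox f B) F x =
  \sum_(t <- tbox B f) \sum_(m < B) \sum_(n < B) F (m : nat, n : nat, t).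
Proof.
rewrite big_allpairs_dep big_allpairs_dep big_mkord [RHS]exchange_big /=.
apply: eq_bigr => m _; rewrite big_mkord [RHS]exchange_big /=.
by apply: eq_bigr.
Qed.

Lemma sum_tbox_geom (K : numFieldType) (r : K) B f :
  \sum_(t <- tbox B f) r ^+ sumn t = (\sum_(i < B) r ^+ i) ^+ f.
Proof.
elim: f => [|f IH]; first by rewrite big_seq1 expr0.
rewrite big_tboxS exprS mulr_suml; apply: eq_bigr => n _.
by rewrite -IH mulr_sumr; apply: eq_bigr => t _; rewrite exprD.
Qed.

Lemma mbox_geom_bounded (R : realType) f (r c : R)
    (F : nat * nat * f.-tuple nat -> R[i]) :
  0 <= c -> 0 <= r < 1 ->
  (forall m n t, `|F (m, n, t)| <= ((c * r ^+ (m + n + sumn t))%:C)%C) ->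
  small_tails F.
Proof.
move=> c0 r01 HF; have r0 : 0 <= r by case/andP: r01.
pose G (x : nat * nat * f.-tuple nat) : R[i] :=
  ((c * r ^+ (x.1.1 + x.1.2 + sumn x.2))%:C)%C.
have G0 x : 0 <= G x by rewrite lecR mulr_ge0 ?exprn_ge0.
apply: (@small_tails_bounded _ _ _ (c * (1 - r)^-1 ^+ f.+2)) => T uT.
have [N HN] := exhaust_subset (@mbox_exhaust f) T.
apply: (@le_trans _ _ (\sum_(x <- mbox f N.+1) G x)).
  apply: (@le_trans _ _ (\sum_(x <- T) G x)).
    by apply: ler_sum => -[[m n] t] _; exact: HF.
  apply: ler_sum_uniq => //; first exact: mbox_uniq.
  exact: HN.
rewrite -rmorph_sum lecR big_mbox /=.
have -> : \sum_(t <- tbox N.+1 f) \sum_(m < N.+1) \sum_(n < N.+1)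
    c * r ^+ (m + n + sumn t) = c * (\sum_(i < N.+1) r ^+ i) ^+ f.+2.
  rewrite !exprS mulrA mulrA -(sum_tbox_geom r) mulr_sumr.
  apply: eq_bigr => t _; rewrite -!mulrA [RHS]mulrA mulr_sumr mulr_suml.
  apply: eq_bigr => m _; rewrite mulr_suml mulr_sumr.
  by apply: eq_bigr => n _; rewrite !exprD; ring.
apply: ler_wpM2l => //; apply: lerXn2r; rewrite ?nnegrE.
- by apply: sumr_ge0 => i _; rewrite exprn_ge0.
- by rewrite invr_ge0 subr_ge0 ltW //; case/andP: r01.
- exact: geom_sum_le.
Qed.

Lemma hterm_le (K : numFieldType) (q E D : K) s l :
  `|q| <= 1 -> 0 <= E -> (forall n : int, `|inv_qpoch q n| <= E) -> E <= D ->
  (forall n, `|qpoch q q n * inv_qpoch q (2 * n)%N| <= D) ->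
  `|hterm q s l| <= D ^+ size l * `|q| ^+ sumn l.
Proof.
move=> q1 E0 HE ED HD; have D0 : 0 <= D := le_trans E0 ED.
elim: l => [|n l IH]; first by rewrite /= normr0 expr0 mul1r expr0.
rewrite [hterm _ _ _]/= [size _]/= [sumn _]/= normrM normrX.
have le1 : `|q| ^+ ((n + sumn l) ^ 2 + (size l < s) * (n + sumn l)) <=
    `|q| ^+ (n + sumn l).
  by apply: ler_wiXn2l => //; nia.
case: l IH le1 => [|m l] IH le1.
  rewrite [leRHS]mulrC; apply: ler_pM => //; by rewrite exprn_ge0.
move: (m :: l) IH le1 => {}l IH le1.
(* Only the power n is taken from this level; the remaining [sumn l] comes from the induction
   hypothesis. *)
have le2 : `|q| ^+ ((n + sumn l) ^ 2 + (size l < s) * (n + sumn l)) <= `|q| ^+ n.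
  by apply: le_trans le1 _; apply: ler_wiXn2l => //; exact: leq_addr.
rewrite normrM [leRHS](_ : _ =
  `|q| ^+ n * (D * (D ^+ size l * `|q| ^+ sumn l))); last first.
  by rewrite [size (n :: l)]/= [sumn (n :: l)]/= exprS exprD; ring.
apply: ler_pM => //; first by rewrite exprn_ge0.
  by rewrite mulr_ge0.
by apply: ler_pM => //; exact: le_trans (HE _) ED.
Qed.

Section Main.
Variables (R : realType) (q : R[i]) (f s : nat).
Hypotheses (hq : `|q| < 1) (q_neq0 : q != 0) (hs : (s <= f.+1)%N).
Local Notation u := (inv_qpoch q).

Definition mterm (x : nat * nat * f.+1.-tuple nat) : R[i] :=
  let: (m, n, t) := x in
  dterm q m n * u ((part t f.+1)%:Z - (2 * m + 3 * n)%:Z) * hterm q s t.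

Lemma dexp_ge (m n : nat) : (m + n <= 2 * m ^ 2 + 6 * m * n + 6 * n ^ 2)%N.
Proof. nia. Qed.

Lemma mterm_small : small_tails mterm.
Proof.
have [r r01 rE] := norm_real hq.
have [E E0 HE] := inv_qpoch_bounded hq.
have hq3 : `|q ^+ 3| < 1 by exact: norm_qexp_lt1.
have q3_neq0 : q ^+ 3 != 0 by exact: expf_neq0.
have [E3 E30 HE3] := inv_qpoch_bounded hq3.
have [L HL] := qpoch_cvg hq q; have [P P0 HP] := seq_lim_bounded HL.
(* [D] bounds both 1/(q;q)_n at the outer levels and (q;q)_n / (q;q)_(2n) at the innermost one. *)
pose D := E + P * E; have ED : E <= D by rewrite lerDl mulr_ge0.
have HD n : `|qpoch q q n * u (2 * n)%N| <= D.
  by rewrite normrM; apply: ler_wpDl => //; apply: ler_pM.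
have D0 : 0 <= D := le_trans E0 ED.
have q1 : `|q| <= 1 by exact: ltW.
have C0 : 0 <= E * E3 * E * D ^+ f.+1 by rewrite !mulr_ge0 ?exprn_ge0.
have [c c0 cE] := norm_realE (E * E3 * E * D ^+ f.+1).
rewrite ger0_norm // in cE.
apply: (@mbox_geom_bounded _ _ r c) => // m n t.
have -> : ((c * r ^+ (m + n + sumn t))%:C)%C =
    E * E3 * E * D ^+ f.+1 * `|q| ^+ (m + n + sumn t).
  by rewrite cE rE rmorphM rmorphXn.
have -> : E * E3 * E * D ^+ f.+1 * `|q| ^+ (m + n + sumn t) =
    `|q| ^+ (m + n) * (E * E3) * E * (D ^+ f.+1 * `|q| ^+ sumn t).
  by rewrite (exprD _ (m + n) (sumn t)); ring.
rewrite /mterm normrM [X in X * _]normrM.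
apply: ler_pM; [exact: mulr_ge0 | by [] | | ]; last first.
  have := hterm_le s t q1 E0 HE ED HD; by rewrite size_tuple.
apply: ler_pM => //.
rewrite /dterm normrM; apply: ler_pM => //.
  by rewrite normrX; apply: ler_wiXn2l => //; exact: dexp_ge.
rewrite invfM normrM; apply: ler_pM => //.
  exact: (HE m).
exact: (HE3 n).
Qed.

(** On the theta side the weights u(M-j) u(M+j) tend to 1/L^2, on the multisum side u(M - N_1) tends
    to 1/L. Equality at each finite M therefore leaves th/L. *)
Lemma mterm_has_sum L th : seq_lim (qpoch q q) L ->
  has_sum (theta_term q f.+1 s) th -> has_sum mterm (th / L).
Proof.
move=> HL Hth.
have nroot := q_nroot hq.
have L0 : L != 0.
  by apply: (qpoch_lim_neq0 hq _ HL) => k; exact: qfactor_neq0.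
have [E E0 HE] := inv_qpoch_bounded hq.
have lim1 : seq_lim (fun M => \sum_(x <- mbox f.+1 M.+1)
    u (M%:Z + - (sumn x.2)%:Z) * mterm x) (L^-1 * L^-1 * th).
  have := @tannery_lim _ _ (theta_term q f.+1 s)
    (fun M j => u (M%:Z + - j) * u (M%:Z + j)) (L^-1 * L^-1) (E * E)
    (fun M => zwin M.+1) (theta_small hq hs) _ _ _ _ _ th Hth.
  move=> H; apply: eq_seq_lim _ (H _ _ _ _ _) => [M||M j|j|M|].
  - rewrite big_zwin big_mbox.
    have -> : zsum M.+1 (fun j => u (M%:Z + - j) * u (M%:Z + j) * theta_term q f.+1 s j)
        = tsum q M.+1 f.+1 s M.
      by apply: eq_zsum => j; rewrite /theta_term; ring.
    rewrite -cterm_sum //; rewrite big_seq [RHS]big_seq; apply: eq_bigr => t.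
    rewrite mem_tbox => /allP ht.
    rewrite -(hterm_cterm q_neq0 nroot); last first.
      by apply: ht; rewrite /part mem_nth // size_tuple.
    rewrite /dconv /dsum mulr_suml mulr_sumr; apply: eq_bigr => m _.
    rewrite mulr_suml mulr_sumr; apply: eq_bigr => n _.
    by rewrite /mterm.
  - exact: mulr_ge0.
  - by rewrite normrM; apply: ler_pM.
  - exact: seq_limM (inv_qpoch_lim (- j) L0 HL) (inv_qpoch_lim j L0 HL).
  - exact: zwin_uniq.
  - exact: zwin_exhaust.
have -> : th / L = L^-1 * L^-1 * th / L^-1 by field.
apply: (@tannery_has_sum _ _ mterm (fun M x => u (M%:Z + - (sumn x.2)%:Z)) L^-1 E
  (fun M => mbox f.+1 M.+1)).
- exact: mterm_small.
- exact: E0.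
- by move=> M x; exact: HE.
- by move=> x; exact: (inv_qpoch_lim (- (sumn x.2)%:Z) L0 HL).
- by move=> M; exact: mbox_uniq.
- exact: mbox_exhaust.
- by rewrite invr_eq0.
- exact: lim1.
Qed.
End Main.

(** * The degenerate case q = 0 *)

Lemma qpoch_0 (K : numFieldType) (b : K) n : qpoch 0 b n = 1.
Proof. by apply: big1 => k _; rewrite mul0r subr0. Qed.

Lemma qpochs_inf_0 (K : numFieldType) (s : seq K) (b : K) :
  all (pred1 0) s -> qpochs_inf s b = 1.
Proof.
move=> /allP s0; apply: seq_limE; apply: eq_seq_lim _ (seq_lim_cst 1) => n.
by rewrite /qpochs big_seq big1 // => a /s0/eqP ->; rewrite qpoch_0.
Qed.

Lemma has_sum_single (K : numFieldType) (I : choiceType) (F : I -> K) (x0 : I) :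
  (forall x, x != x0 -> F x = 0) -> has_sum F (F x0).
Proof.
move=> F0; apply/has_sumP => e e0; exists [:: x0] => T uT sT.
have x0T : x0 \in T by apply: sT; rewrite inE.
rewrite (bigD1_seq x0) //= big1 => [|x /F0 //].
by rewrite addr0 subrr normr0.
Qed.

(** Since 0^0 = 1, only terms with exponent 0 survive, and the quadratic form forces all variables
    to be 0. *)
Lemma mterm0_has_sum (R : realType) f s : has_sum (@mterm R 0 f s) 1.
Proof.
pose x0 : nat * nat * f.+1.-tuple nat := (0%N, 0%N, nseq_tuple f.+1 0%N).
have u0 : inv_qpoch (0 : R[i]) 0%N = 1 by rewrite /inv_qpoch qpoch0 invr1.
have h1 k : hterm (0 : R[i]) s (nseq k.+1 0%N) = 1.
  elim: k => [|k IH].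
    rewrite [hterm _ _ _]/= (_ : (_ + _)%N = 0%N); last by rewrite muln0.
    by rewrite expr0 mul1r qpoch0 muln0 u0 mulr1.
  have -> : hterm (0 : R[i]) s (nseq k.+2 0%N) =
      0 ^+ (sumn (nseq k.+2 0%N) ^ 2 + (k.+1 < s)%N * sumn (nseq k.+2 0%N))
      * (inv_qpoch 0 0%N * hterm 0 s (nseq k.+1 0%N)) by rewrite /= size_nseq.
  by rewrite IH u0 sumn_nseq mul0n muln0 expr0 !mulr1.
have h0 t : sumn (tval t) != 0%N -> hterm (0 : R[i]) s (tval (t : f.+1.-tuple nat)) = 0.
  case/tupleP: t => n t /= h.
  rewrite expr0n addn_eq0 expn_eq0 (negbTE h) /= mul0r //.
have <- : @mterm R 0 f s x0 = 1.
  rewrite /x0 /mterm (h1 f : hterm 0 s (nseq_tuple f.+1 0%N) = 1) mulr1.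
  rewrite (_ : part _ _ = 0%N); last by rewrite /part nth_nseq ltnSn.
  have -> : 0%N%:Z - (2 * 0 + 3 * 0)%:Z = 0%N by [].
  by rewrite u0 mulr1 /dterm expr0 !qpoch0 mulr1 invr1 mulr1.
apply: has_sum_single => -[[m n] t] xx0.
have [tt|tt] := eqVneq (sumn t) 0%N; last by rewrite /mterm h0 ?mulr0.
have [mn|mn] := eqVneq (2 * m ^ 2 + 6 * m * n + 6 * n ^ 2)%N 0%N; last first.
  by rewrite /mterm /dterm expr0n (negbTE mn) !mul0r.
case/eqP: xx0; have [-> ->] : m = 0%N /\ n = 0%N by lia.
congr (_, _, _); apply: val_inj => /=.
have : all (pred1 0%N) t.
  apply/allP => i it; move: tt; rewrite sumnE (big_rem i) //= => /eqP.
  by rewrite addn_eq0 => /andP[].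
by move=> /all_pred1P; rewrite size_tuple.
Qed.

Local Open Scope complex_scope.

Theorem theorem9 (R : realType) (f s : nat) (q : R[i])
    (hf : (0 < f)%N) (hs : (s <= f)%N) (hq : `|q| < 1) :
  has_sum
    (fun x : nat * nat * f.-tuple nat =>
      let: (m, n, ns) := x in
      q ^+ (2 * m ^ 2 + 6 * m * n + 6 * n ^ 2
            + \sum_(1 <= i < f.+1) tail_sum ns i ^ 2
            + \sum_(f - s + 1 <= i < f.+1) tail_sum ns i)%N
      * qpoch q q (part ns f)
      / (qpoch q q m * qpoch (q ^+ 3) (q ^+ 3) n
         * (\prod_(1 <= i < f) qpoch q q (part ns i))
         * qpoch q q (2 * part ns f)%N)
      * inv_qpoch q ((part ns f)%:Z - 3%:Z * n%:Z - 2%:Z * m%:Z))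
    (qpochs_inf [:: q ^+ (f + 1 - s)%N; q ^+ (5 * f + 5 + s)%N;
                    q ^+ (6 * (f + 1))%N]
       (q ^+ (6 * (f + 1))%N)
     * qpochs_inf [:: q ^+ (4 * f + 4 + 2 * s)%N;
                      q ^+ (8 * f + 8 - 2 * s)%N]
         (q ^+ (12 * (f + 1))%N)
     / qpochs_inf [:: q] q).
Proof.
case: f hf hs => // f _ hs.
rewrite (_ : (fun x => _) = @mterm R q f s); last first.
  by apply/funext => -[[m n] t]; exact: multisum_termE.
(* The recurrences divide by powers of q. At q = 0 every product on the right is 1, because all its
   exponents are positive. *)
have [q0|q_neq0] := eqVneq q 0.
  have z k : (0 < k)%N -> (0 : R[i]) ^+ k == 0.
    by move=> k0; rewrite expf_eq0 k0 eqxx.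
  have [k1 k2] : (0 < f.+1 + 1 - s /\ 0 < 8 * f.+1 + 8 - 2 * s)%N by lia.
  rewrite {}q0 !qpochs_inf_0 ?divr1 ?mulr1; first exact: mterm0_has_sum.
  - by rewrite /= eqxx.
  - by rewrite /= !z // addn_gt0.
  - by rewrite /= !z // addn_gt0.
pose Q := q ^+ (6 * (f.+1 + 1)); pose y := q ^+ (f.+1 + 1 - s).
have Q_neq0 : Q != 0 by exact: expf_neq0.
have y_neq0 : y != 0 by exact: expf_neq0.
have hQ : `|Q| < 1 by apply: norm_qexp_lt1.
have hQ2 : `|Q ^+ 2| < 1 by apply: norm_qexp_lt1.
have [LQ HQ] := qpoch_cvg hQ Q; have [ly Hy] := qpoch_cvg hQ y.
have [lyq Hyq] := qpoch_cvg hQ (Q / y).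
have [lA HA] := qpoch_cvg hQ2 (y ^+ 2 * Q).
have [lB HB] := qpoch_cvg hQ2 (Q / y ^+ 2).
have [L HL] := qpoch_cvg hq q.
have e1 : Q / y = q ^+ (5 * f.+1 + 5 + s).
  by apply: (mulIf y_neq0); rewrite divfK // -exprD; congr (_ ^+ _); lia.
have e2 : Q / y ^+ 2 = q ^+ (4 * f.+1 + 4 + 2 * s).
  apply: (mulIf (expf_neq0 2 y_neq0)); rewrite divfK ?expf_neq0 //.
  by rewrite -exprM -exprD; congr (_ ^+ _); lia.
have e3 : y ^+ 2 * Q = q ^+ (8 * f.+1 + 8 - 2 * s).
  by rewrite -exprM -exprD; congr (_ ^+ _); lia.
have e4 : Q ^+ 2 = q ^+ (12 * (f.+1 + 1)).
  by rewrite -exprM; congr (_ ^+ _); lia.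
have -> : qpochs_inf [:: q] q = L.
  apply: seq_limE; apply: eq_seq_lim _ HL => n.
  by rewrite /qpochs big_seq1.
rewrite -e1 -e2 -e3 -e4 -/Q -/y.
have -> : qpochs_inf [:: y; Q / y; Q] Q = ly * lyq * LQ.
  apply: seq_limE; apply: eq_seq_lim _ (seq_limM (seq_limM Hy Hyq) HQ) => n.
  by rewrite /qpochs !big_cons big_nil mulr1 mulrA.
have -> : qpochs_inf [:: Q / y ^+ 2; y ^+ 2 * Q] (Q ^+ 2) = lA * lB.
  apply: seq_limE; apply: eq_seq_lim _ (seq_limM HA HB) => n.
  by rewrite /qpochs !big_cons big_nil mulr1 mulrC.
apply: mterm_has_sum => //.
exact: theta_has_sum.
Qed.
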